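(* Consider the winner-take-all patent race described in the context with $n\ge2$ firms, discount rate $r>0$, and a cost functional $C:\mathcal F\to\mathbb R$ satisfying (A) and (B). Let $F\in\mathcal F$ be a symmetric equilibrium and let $G\in\mathcal F$ maximize the planner objective $v$ over $\mathcal F$. Then $F(t)\ge G(t)$ for all $t\in[0,\infty]$.
   Context: $\mathcal F$ is the set of cdfs on $[0,\infty]$: $H\in\mathcal F$ is nondecreasing with values in $[0,1]$, right-continuous on $[0,\infty)$, and $H(\infty)=1$; it induces a probability measure $dH$ on $[0,\infty]$ with $dH([0,t])=H(t)$ (mass at $\infty$ means never discovering). Let $V(t)=e^{-rt}$ for $t<\infty$ and $V(\infty)=0$. Game: each firm $i=1,\dots,n$ chooses $F_i\in\mathcal F$; breakthrough times $T_i\sim dF_i$ are drawn independently. The firm with the smallest breakthrough time receives the discounted prize $V(\min_j T_j)$, other firms receive $0$, and ties for the minimum are broken uniformly (so each of $m$ firms tied at the minimum has expected gross payoff $V(\min_jT_j)/m$). Firm $i$'s net payoff $u_i(F_1,\dots,F_n)$ is its expected gross payoff minus $C(F_i)$. $F$ is a symmetric equilibrium if $u_1(F,F,\dots,F)\ge u_1(H,F,\dots,F)$ for all $H\in\mathcal F$. The planner's objective is $v(H)=u_1(H,\dots,H)=\frac1n\mathbb E[V(\min_{1\le j\le n}T_j)]-C(H)$ with $T_1,\dots,T_n\sim dH$ i.i.d. Let $\eta$ be a finite non-atomic positive Borel measure on $[0,\infty]$ with $\eta(\{\infty\})=0$. Write $\delta C(H;K-H)=\lim_{\varepsilon\downarrow0}\varepsilon^{-1}[C((1-\varepsilon)H+\varepsilon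 K)-C(H)]$ and $\varphi^+=\max\{\varphi,0\}$. (A) For every $H\in\mathcal F$ there exists $m_H\in L^1(\eta)$ such that for every $K\in\mathcal F$ the limit $\delta C(H;K-H)$ exists and equals $\int_{[0,\infty]}m_H(t)(K(t)-H(t))\,d\eta(t)$. Moreover, for all $F,G\in\mathcal F$, $\int_{[0,\infty]}(G(t)-F(t))^+(m_G(t)-m_F(t))\,d\eta(t)\ge0$. (B) Put $c_H(\tau)=\int_{[\tau,\infty]}m_H(t)\,d\eta(t)$ for $\tau<\infty$ and $c_H(\infty)=0$. There exists $\eta_0>0$ such that $c_H(0)\ge1+\eta_0$ for every $H\in\mathcal F$. *)

(* Defs.v *)
From HB Require Import structures.
From mathcomp Require Import all_boot all_order all_algebra.
From mathcomp Require Import all_classical all_reals all_analysis.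
From mathcomp Require Import measurable_realfun.

Set Implicit Arguments.
Unset Strict Implicit.
Unset Printing Implicit Defensive.

Import Order.TTheory GRing.Theory Num.Theory.
Import numFieldNormedType.Exports.

Local Open Scope classical_set_scope.
Local Open Scope ring_scope.

(* The time axis [0, +oo] is the nonnegative part of [\bar R]. *)
Definition times (R : realType) : set (\bar R) := [set t | (0 <= t)%E].
Arguments times {R}.

(* A cdf on [0, +oo] is represented by its extension by 0 to negative
   arguments, so that distinct representatives are distinct cdfs. *)
Record is_cdf (R : realType) (H : \bar R -> R) : Prop := IsCdf {
  cdf_neg : forall t : \bar R, (t < 0)%E -> H t = 0;
  cdf_nondecr : forall s t : \bar R, (0 <= s)%E -> (s <= t)%E -> H s <= H t;
  cdf_itv01 : forall t : \bar R, (0 <= t)%E -> 0 <= H t <= 1;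
  cdf_right_cont : forall x : R, 0 <= x -> H y%:E @[y --> x^'+] --> H x%:E;
  cdf_infty : H +oo%E = 1 }.

(* [dH], characterized by [dH [0, t] = H t]: see [cdf_lawE] and
   [cdf_law_unique]. *)
Definition cdf_law (R : realType) (H : \bar R -> R) : probability (\bar R) R :=
  get [set P : probability (\bar R) R |
        forall t : \bar R, (0 <= t)%E -> P [set s | (0 <= s <= t)%E] = (H t)%:E].

Section product_law.
Context d (T : measurableType d) (R : realType).

Definition tcons n (x : T * n.-tuple T) : n.+1.-tuple T :=
  [the n.+1.-tuple T of x.1 :: x.2].

Lemma measurable_tcons n : measurable_fun [set: T * n.-tuple T] (@tcons n).
Proof. exact: measurable_cons. Qed.

HB.instance Definition _ n :=
  @isMeasurableFun.Build _ _ (T * n.-tuple T)%type (n.+1.-tuple T)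
    (@tcons n) (@measurable_tcons n).

(* The law of an independent family of draws from the P i: see
   [product_lawE]. *)
Fixpoint product_law n : ('I_n -> probability T R) ->
    probability (n.-tuple T) R :=
  match n with
  | 0 => fun=> dirac [tuple]
  | n'.+1 => fun P => distribution
      (P ord0 \x product_law (fun i => P (lift ord0 i)))%E (@tcons n')
  end.

Lemma measurable_box n (A : 'I_n -> set T) :
  (forall i, measurable (A i)) ->
  measurable [set t : n.-tuple T | forall i, A i (tnth t i)].
Proof.
move=> mA.
rewrite (_ : [set _ | _] = \bigcap_(i in [set: 'I_n]) (tnth (T:=T) ^~ i) @^-1` A i).
  apply: fin_bigcap_measurable; [exact: (@finite_finset (ordinal n))|].
  by move=> i _; rewrite -[X in measurable X]setTI; exact: measurable_tnth.
by apply/seteqP; split => t /= h i => [_|]; exact: h.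
Qed.

Lemma product_lawE n (P : 'I_n -> probability T R) (A : 'I_n -> set T) :
  (forall i, measurable (A i)) ->
  product_law P [set t | forall i, A i (tnth t i)] =
  (\prod_(i < n) P i (A i))%E.
Proof.
elim: n P A => [|n IH] P A mA.
  by rewrite big_ord0 /= diracE mem_set// => -[].
rewrite big_ord_recl -IH//= /distribution /pushforward.
rewrite (_ : _ @^-1` _ = A ord0 `*`
    [set t : n.-tuple T | forall i, A (lift ord0 i) (tnth t i)]).
  by rewrite product_measure1E//; exact: (@measurable_box n (fun i => A (lift ord0 i))).
apply/seteqP; split => -[x t] /=.
  move=> h; split; first exact: (h ord0).
  by move=> i; have := h (lift ord0 i); rewrite tnthS.
move=> [h0 h] i; case: (unliftP ord0 i) => [j|] ->//=.
by rewrite tnthS.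
Qed.

End product_law.

Section existence.
Context (R : realType).
Implicit Types (H : \bar R -> R) (t : \bar R).

Section stieltjes.
Variables (H : \bar R -> R) (cH : is_cdf H).

Let f (x : R) : R := H x%:E.

Let f_neg x : x < 0 -> f x = 0.
Proof. by move=> x0; rewrite /f (cdf_neg cH)// lte_fin. Qed.

Let f_itv01 x : 0 <= f x <= 1.
Proof.
have [x0|x0] := ltP x 0; first by rewrite f_neg// lexx ler01.
exact: (cdf_itv01 cH).
Qed.

Let f_nd : nondecreasing f.
Proof.
move=> x y xy; have [x0|x0] := ltP x 0.
  by rewrite f_neg//; have /andP[] := f_itv01 y.
exact: (cdf_nondecr cH).
Qed.

Let f_rc : right_continuous f.
Proof.
move=> x; have [x0|x0] := ltP x 0; last exact: (cdf_right_cont cH).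
rewrite f_neg//; apply: cvg_near_cst; near=> y.
by apply/eqP; rewrite f_neg//; near: y; exact: nbhs_right_lt.
Unshelve. all: by end_near. Qed.

HB.instance Definition _ := isCumulative.Build R _ R f f_nd f_rc.

Let lsf := lebesgue_stieltjes_measure f.

Let lsf_itv (a b : R) : a <= b -> lsf `]a, b]%classic = (f b - f a)%:E.
Proof.
move=> ab; rewrite /lsf /lebesgue_stieltjes_measure /measure_extension/=.
by rewrite measurable_mu_extE/=; [rewrite wlength_itv_bnd|exact: is_ocitv].
Qed.

Let lsf_ray (r : R) : lsf `]-oo, r]%classic = (f r)%:E.
Proof.
rewrite itvNybndEbigcup.
have : lsf `]-n%:R, r]%classic @[n --> \oo] --> (f r)%:E.
  apply: cvg_near_cst; near=> n.
  have rn : - n%:R <= r.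
    by rewrite lerNl; near: n; exact: nbhs_infty_ger.
  rewrite lsf_itv// (f_neg (x := - n%:R)) ?subr0//.
  rewrite oppr_lt0 ltr0n; near: n; exact: nbhs_infty_gt.
have : lsf `]- n%:R, r]%classic @[n --> \oo] -->
    lsf (\bigcup_n `]-n%:R, r]%classic).
  apply: nondecreasing_cvg_mu => //; first exact: bigcup_measurable.
  by move=> *; apply/subsetPset/subset_itv; rewrite leBSide//= lerN2 ler_nat.
exact: cvg_unique.
Unshelve. all: by end_near. Qed.

Let lsf_neg : lsf `]-oo, 0[%classic = 0%E.
Proof.
have -> : `]-oo, (0:R)[%classic = \bigcup_n `]-oo, - n.+1%:R^-1]%classic.
  apply/seteqP; split => x /=; rewrite in_itv/=.
    move=> x0; exists (Num.truncn (- x^-1)) => //=; rewrite in_itv/=.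
    rewrite lerNr -[leRHS]invrK lef_pV2 ?posrE ?ltr0n ?invr_gt0 ?oppr_gt0//.
    by rewrite invrN ltW// truncnS_gt.
  by move=> [n _ /=]; rewrite in_itv/= => /le_lt_trans; apply; rewrite oppr_lt0 invr_gt0.
apply/eqP; rewrite -measure_le0.
apply: (le_trans (@measure_sigma_subadditive _ _ _ lsf _ _ _ _ (@subset_refl _ _))).
- by move=> n; exact: measurable_itv.
- by apply: bigcup_measurable => n _; exact: measurable_itv.
- rewrite eseries0// => n _ _.
  by apply: (etrans (lsf_ray _)); rewrite f_neg// oppr_lt0 invr_gt0.
Qed.

Let lsfT_le1 : (lsf setT <= 1)%E.
Proof.
have -> : [set: R] = \bigcup_n `]-oo, n%:R]%classic.
  apply/esym; rewrite -subTset => x _; exists (Num.truncn x).+1 => //=.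
  by rewrite in_itv/= ltW// truncnS_gt.
have : lsf `]-oo, n%:R]%classic @[n --> \oo] -->
    lsf (\bigcup_n `]-oo, n%:R]%classic).
  apply: nondecreasing_cvg_mu => //; first exact: bigcup_measurable.
  by move=> *; apply/subsetPset/subset_itvl; rewrite bnd_simp ler_nat.
move=> h; apply: (cvge_le _ h); apply: nearW => n.
by rewrite lsf_ray lee_fin; have /andP[] := f_itv01 n%:R.
Qed.

Let c0 : 0 <= 1 - fine (lsf setT).
Proof.
by rewrite subr_ge0 -lee_fin fineK// ge0_fin_numE// (le_lt_trans lsfT_le1)// ltry.
Qed.

Let mEFin : measurable_fun [set: measurableTypeR R] (@EFin R).
Proof. exact: EFin_measurable. Qed.

Let lsfE : {measure set (\bar R) -> \bar R} :=
  measure_function_pushforward__canonical__measure_function_Measure lsf mEFin.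

Let P : set (\bar R) -> \bar R :=
  measure_add lsfE (mscale (NngNum c0) (dirac +oo%E)).

Let PE A : P A = (lsf (@EFin R @^-1` A) +
  (1 - fine (lsf setT))%:E * \d_(+oo%E) A)%E.
Proof. exact: measure_addE. Qed.

HB.instance Definition _ := Measure.on P.

Let P_setT : P setT = 1%E.
Proof.
rewrite PE preimage_setT diracE mem_set// mule1.
have fl : lsf setT \is a fin_num.
  by rewrite ge0_fin_numE// (le_lt_trans lsfT_le1)// ltry.
by rewrite -[X in (X + _)%E](fineK fl) -EFinD addrC subrK.
Qed.

HB.instance Definition _ := Measure_isProbability.Build _ _ _ P P_setT.

Lemma cdf_law_exists : exists Q : probability (\bar R) R,
  forall t : \bar R, (0 <= t)%E -> Q [set s | (0 <= s <= t)%E] = (H t)%:E.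
Proof.
exists P => t.
have mneg (b : itv_bound R) : measurable ([set` Interval (BLeft 0) b] : set (measurableTypeR R)).
  exact: measurable_itv.
have split0 (b : itv_bound R) : (BLeft 0 <= b)%O ->
    lsf [set` Interval -oo%O b] = lsf [set` Interval (BLeft 0) b].
  move=> b0.
  have -> : [set` Interval -oo%O b] =
    `]-oo, 0[%classic `|` [set` Interval (BLeft (0:R)) b].
    by rewrite -itv_bndbnd_setU// bnd_simp.
  apply: (etrans (measureU _ _ _ _)); last 1 first.
  - by apply: (etrans (congr1 (fun z => z + _)%E lsf_neg)); rewrite add0e.
  - exact: measurable_itv.
  - exact: mneg.
  - apply/seteqP; split => x //= -[]; rewrite !in_itv/= => x0 /andP[].
    by rewrite leNgt x0.
case: t => [t| |] //.
- rewrite lee_fin => t0; rewrite [LHS]PE diracE memNset ?mule0 ?adde0/=; last first.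
    by case/andP => _; rewrite leye_eq.
  rewrite (_ : _ @^-1` _ = `[0, t]%classic).
    by rewrite -split0 ?bnd_simp// lsf_ray.
  by apply/seteqP; split => x /=; rewrite in_itv/= !lee_fin.
- move=> _; rewrite (cdf_infty cH) -P_setT [LHS]PE PE preimage_setT !diracE !mem_set//=;
    last by rewrite leey lexx.
  congr (_ + _)%E.
  rewrite (_ : _ @^-1` _ = `[0, +oo[%classic).
    by rewrite -split0 ?set_itvE.
  by apply/seteqP; split => x /=; rewrite in_itv/= ?andbT lee_fin ?leey ?andbT.
Qed.

End stieltjes.

Lemma cdf_lawE H : is_cdf H -> forall t : \bar R, (0 <= t)%E ->
  cdf_law H [set s | (0 <= s <= t)%E] = (H t)%:E.
Proof. by move=> cH; exact: (getPex (cdf_law_exists cH)). Qed.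

Lemma cdf_law_unique H (P : probability (\bar R) R) : is_cdf H ->
  (forall t : \bar R, (0 <= t)%E -> P [set s | (0 <= s <= t)%E] = (H t)%:E) ->
  forall A, measurable A -> P A = cdf_law H A.
Proof.
move=> cH PH.
pose G : set (set (\bar R)) :=
  [set A | A = setT \/ exists r, A = `]r%:E, +oo[%classic].
have mG : (measurable : set (set (\bar R))) = <<s G >>.
  apply: (etrans (ErealGenOInfty.measurableE R)); apply/seteqP; split.
    by apply: sub_sigma_algebra2 => A [r ->]; right; exists r.
  apply: smallest_sub; first exact: smallest_sigma_algebra.
  move=> A [->|[r ->]].
    rewrite -setC0 -setTD; apply: sigma_algebraCD; exact: sigma_algebra0.
  by apply: sub_sigma_algebra; exists r.
have mitv t : measurable [set s : \bar R | (0 <= s <= t)%E].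
  rewrite (_ : [set _ | _] = `[0%E, t]%classic); first exact: emeasurable_itv.
  by apply/seteqP; split => x /=; rewrite in_itv.
have key (Q : probability (\bar R) R) (r : R) :
    (forall t : \bar R, (0 <= t)%E -> Q [set s | (0 <= s <= t)%E] = (H t)%:E) ->
    Q `]r%:E, +oo[%classic = (1 - H r%:E)%:E.
  move=> QH.
  have Q0 A : measurable A -> A `<=` [set s | (s < 0)%E] -> Q A = 0%E.
    move=> mA A0; apply/eqP; rewrite -measure_le0.
    have : Q (~` [set s | (0 <= s <= +oo)%E]) = 0%E.
      by rewrite probability_setC// QH// (cdf_infty cH) subee.
    move=> <-; apply: le_measure; rewrite ?inE//; first exact: measurableC.
    by move=> x /A0/= x0 /andP[]; rewrite leNgt x0.
  rewrite EFinB; have [r0|r0] := ltP r 0.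
    rewrite (cdf_neg cH) ?lte_fin// sube0.
    rewrite -(setCK `]r%:E, +oo[%classic) probability_setC; last first.
      exact/measurableC/emeasurable_itv.
    rewrite Q0 ?sube0//; first exact/measurableC/emeasurable_itv.
    move=> x /=; rewrite in_itv/= andbT => /negP; rewrite -leNgt => /le_lt_trans.
    by apply; rewrite lte_fin.
  rewrite -QH ?lee_fin// -probability_setC//.
  have -> : ~` [set s : \bar R | (0 <= s <= r%:E)%E] =
      [set s | (s < 0)%E] `|` `]r%:E, +oo[%classic.
    apply/seteqP; split => x /=; rewrite in_itv/= andbT.
      by move=> /negP; rewrite negb_and -!ltNge => /orP.
    by move=> h; apply/negP; rewrite negb_and -!ltNge; apply/orP.
  have mneg : measurable [set s : \bar R | (s < 0)%E].
    rewrite (_ : [set _ | _] = `]-oo, 0%E[%classic); first exact: emeasurable_itv.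
    by apply/seteqP; split => x /=; rewrite in_itv.
  apply: esym; apply: (etrans (measureU _ mneg (emeasurable_itv _) _)); last first.
    by rewrite [X in (X + _)%E]Q0// add0e.
  apply/seteqP; split => x //= -[x0]; rewrite in_itv/= andbT => rx.
  by have := lt_trans rx x0; rewrite lte_fin ltNge r0.
apply: (@measure_unique _ R (\bar R : measurableType _) G (fun=> setT)) => //.
- move=> A B [->|[r ->]] [->|[s ->]]; rewrite ?setTI ?setIT.
  + by left.
  + by right; exists s.
  + by right; exists r.
  + right; exists (Num.max r s); apply/seteqP; split => x /=.
      rewrite !in_itv/= !andbT EFin_max gt_max => -[-> ->]//.
    by rewrite !in_itv/= !andbT EFin_max gt_max => /andP[].
- by move=> _; left.
- by rewrite bigcup_const//; exists 0%N.
- move=> A [->|[r ->]]; first exact: (etrans (probability_setT P) (esym (probability_setT _))).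
  exact: (etrans (key P r PH) (esym (key _ r (cdf_lawE cH)))).
- by move=> k; rewrite /= -ge0_fin_numE// fin_num_measure.
Qed.

End existence.

Section game.
Context (R : realType).
Implicit Types (H K F G : \bar R -> R) (C : (\bar R -> R) -> R).

Definition discount (r : R) (t : \bar R) : R :=
  if t is x%:E then expR (- (r * x)) else 0.

Definition gross_payoff (r : R) n (i : 'I_n) (t : n.-tuple (\bar R)) : R :=
  let first := \big[Order.min/+oo%E]_(j < n) tnth t j in
  if tnth t i == first
  then discount r first / #|[pred j : 'I_n | tnth t j == first]|%:R
  else 0.

(* Only the values of the cost functional C on cdfs matter. *)
Definition payoff (r : R) C n (i : 'I_n) (F : 'I_n -> \bar R -> R) : R :=
  (\int[product_law (fun j => cdf_law (F j))]_t gross_payoff r i t) - C (F i).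

Definition deviation n (i : 'I_n) H F : 'I_n -> \bar R -> R :=
  fun j => if j == i then H else F.

Definition firm1 n (n2 : (2 <= n)%N) : 'I_n := Ordinal (ltnW n2).

Definition symmetric_equilibrium (r : R) C n (n2 : (2 <= n)%N) F : Prop :=
  is_cdf F /\ forall H, is_cdf H ->
    payoff r C (firm1 n2) (deviation (firm1 n2) H F) <=
    payoff r C (firm1 n2) (fun=> F).

Definition planner (r : R) C n (n2 : (2 <= n)%N) H : R :=
  payoff r C (firm1 n2) (fun=> H).

Definition planner_optimal (r : R) C n (n2 : (2 <= n)%N) G : Prop :=
  is_cdf G /\ forall H, is_cdf H -> planner r C n2 H <= planner r C n2 G.

End game.

Definition nonatomic d (T : measurableType d) (R : realType)
    (mu : {measure set T -> \bar R}) : Prop :=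
  forall A, measurable A -> (0 < mu A)%E ->
    exists B, [/\ measurable B, B `<=` A & (0 < mu B < mu A)%E].

Section cost.
Context (R : realType).
Implicit Types (H K F G : \bar R -> R) (C : (\bar R -> R) -> R).
Variable eta : {measure set (\bar R) -> \bar R}.

Definition mixture (e : R) H K : \bar R -> R :=
  fun t => (1 - e) * H t + e * K t.

(* m H is the L^1(eta) density representing the directional derivatives of C
   at H. *)
Definition cost_density C (m : (\bar R -> R) -> \bar R -> R) : Prop :=
  forall H, is_cdf H ->
    eta.-integrable times (EFin \o m H) /\
    forall K, is_cdf K ->
      e^-1 * (C (mixture e H K) - C H) @[e --> 0^'+] -->
        \int[eta]_(t in times) (m H t * (K t - H t)).

Definition monotone_density (m : (\bar R -> R) -> \bar R -> R) : Prop :=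
  forall F G, is_cdf F -> is_cdf G ->
    0 <= \int[eta]_(t in times) (Num.max (G t - F t) 0 * (m G t - m F t)).

Definition marginal_cost (m : (\bar R -> R) -> \bar R -> R) H (tau : \bar R) : R :=
  if tau == +oo%E then 0 else \int[eta]_(t in [set t | (tau <= t)%E]) m H t.

End cost.

(* Main.v *)
(* Write L for the law with survival function V, so that a discount factor is
   the probability of surviving an independent exponential clock. Against
   rivals playing F, entering at time t wins at most V(t) P(t <= all rivals),
   and advancing a strategy H by d > 0 wins at least this bound at the original
   times (ties become wins), provided F has no atom at 0, which (B) ensures in
   equilibrium. Seen from the minimum of the clock and the rivals' times, the
   bound averages to E[H(min)]. Hence the deviation to max(F, G), advanced by
   d -> 0, gives
     int (G-F)^+ (1-F)^(n-1) dL <= int (G-F)^+ m_F d eta,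
   while the planner's deviation from G to min(F, G) gives
     int (G-F)^+ m_G d eta <= int (G-F)^+ (1-G)^(n-1) dL.
   Monotonicity of m chains the two, and 1-F > 1-G wherever G > F, so
   (G-F)^+ vanishes L-almost everywhere, hence everywhere by right
   continuity. *)
Require Import Defs.
From HB Require Import structures.
From mathcomp Require Import all_boot all_order all_algebra.
From mathcomp Require Import all_classical all_reals all_analysis.
From mathcomp Require Import measurable_realfun perm ring lra.

Import Order.TTheory GRing.Theory Num.Theory.
Import numFieldNormedType.Exports.

Local Open Scope classical_set_scope.
Local Open Scope ring_scope.

Set Implicit Arguments.
Unset Strict Implicit.
Unset Printing Implicit Defensive.

(** * Operations on cdfs *)

Lemma cvg_maxr (R : realFieldType) (T : Type) (A : set_system T) (FA : Filter A)
    (f g : T -> R) (a b : R) : f @ A --> a -> g @ A --> b ->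
  Num.max (f x) (g x) @[x --> A] --> Num.max a b.
Proof.
move=> fa gb; rewrite maxr_absE; under eq_fun do rewrite maxr_absE.
by apply: cvgM (cvg_cst _); apply: cvgD; [exact: cvgD|apply: cvg_norm; exact: cvgB].
Qed.

Lemma cvg_minr (R : realFieldType) (T : Type) (A : set_system T) (FA : Filter A)
    (f g : T -> R) (a b : R) : f @ A --> a -> g @ A --> b ->
  Num.min (f x) (g x) @[x --> A] --> Num.min a b.
Proof.
move=> fa gb; rewrite minr_absE; under eq_fun do rewrite minr_absE.
by apply: cvgM (cvg_cst _); apply: cvgB; [exact: cvgD|apply: cvg_norm; exact: cvgB].
Qed.

Section cdf_theory.
Context (R : realType).
Implicit Types (F G H K : \bar R -> R) (s t : \bar R).

Lemma is_cdf_ge0 H t : is_cdf H -> 0 <= H t.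
Proof.
move=> cH; have [t0|t0] := ltP t 0%E; first by rewrite (cdf_neg cH).
by have /andP[] := cdf_itv01 cH t0.
Qed.

Lemma is_cdf_le1 H t : is_cdf H -> H t <= 1.
Proof.
move=> cH; have [t0|t0] := ltP t 0%E; first by rewrite (cdf_neg cH).
by have /andP[] := cdf_itv01 cH t0.
Qed.

Lemma is_cdf_le H s t : is_cdf H -> (s <= t)%E -> H s <= H t.
Proof.
move=> cH st; have [s0|s0] := ltP s 0%E; last exact: (cdf_nondecr cH).
by rewrite (cdf_neg cH)// is_cdf_ge0.
Qed.

Lemma cdf_mixture (e : R) H K : 0 <= e <= 1 -> is_cdf H -> is_cdf K ->
  is_cdf (mixture e H K).
Proof.
move=> /andP[e0 e1] cH cK; have e1' : 0 <= 1 - e by rewrite subr_ge0.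
rewrite /mixture; split.
- by move=> t t0; rewrite (cdf_neg cH t0) (cdf_neg cK t0) !mulr0 addr0.
- by move=> s t _ st; apply: lerD; apply: ler_wpM2l => //; exact: is_cdf_le.
- move=> t _.
  rewrite addr_ge0 ?(mulr_ge0 e1' (is_cdf_ge0 t cH)) ?(mulr_ge0 e0 (is_cdf_ge0 t cK))//=.
  by rewrite -[leRHS](subrK e) lerD// ler_piMr// is_cdf_le1.
- move=> x x0.
  apply: cvgD; apply: (cvgM (cvg_cst _)).
    exact: (cdf_right_cont cH x0).
  exact: (cdf_right_cont cK x0).
- by rewrite (cdf_infty cH) (cdf_infty cK) !mulr1 subrK.
Qed.

Lemma cdf_max H K : is_cdf H -> is_cdf K ->
  is_cdf (fun t => Num.max (H t) (K t)).
Proof.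
move=> cH cK; split.
- by move=> t t0; rewrite (cdf_neg cH t0) (cdf_neg cK t0) maxxx.
- by move=> s t _ st; rewrite ge_max !le_max !(is_cdf_le _ st)// orbT.
- by move=> t _; rewrite le_max is_cdf_ge0//= ge_max !is_cdf_le1.
- by move=> x x0; apply: cvg_maxr; exact: cdf_right_cont.
- by rewrite (cdf_infty cH) (cdf_infty cK) maxxx.
Qed.

Lemma cdf_min H K : is_cdf H -> is_cdf K ->
  is_cdf (fun t => Num.min (H t) (K t)).
Proof.
move=> cH cK; split.
- by move=> t t0; rewrite (cdf_neg cH t0) (cdf_neg cK t0) minxx.
- by move=> s t _ st; rewrite le_min !ge_min !(is_cdf_le _ st)// orbT.
- by move=> t _; rewrite le_min !is_cdf_ge0//= ge_min is_cdf_le1.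
- by move=> x x0; apply: cvg_minr; exact: cdf_right_cont.
- by rewrite (cdf_infty cH) (cdf_infty cK) minxx.
Qed.

(** The law of max(T - d, 0) for T of law dH ([integral_law_advance]): breakthroughs due before d
    are gathered at time 0. *)
Definition advance (d : R) H : \bar R -> R :=
  fun t => if (t < 0)%E then 0 else H (t + d%:E)%E.

Lemma cdf_advance (d : R) H : 0 <= d -> is_cdf H -> is_cdf (advance d H).
Proof.
move=> d0 cH; rewrite /advance; split.
- by move=> t ->.
- by move=> s t s0 st; rewrite !ltNge s0 (le_trans s0 st)/= is_cdf_le// leeD2r.
- by move=> t t0; rewrite ltNge t0/= is_cdf_ge0// is_cdf_le1.
- move=> x x0; rewrite lte_fin ltNge x0/= -EFinD.
  have := cdf_right_cont cH (addr_ge0 x0 d0).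
  move=> h; apply: (@cvg_trans _ ((fun y => H (y + d)%:E) @ x^'+)).
    apply: near_eq_cvg; near=> y.
    by rewrite lte_fin ltNge (ltW (le_lt_trans x0 _))//=; near: y; exact: nbhs_right_gt.
  move: h; apply: cvg_trans => A /= [e e0 eA]; exists e => //= y yx xy.
  apply: eA => /=; last by rewrite ltrD2r.
  by move: yx; rewrite /= opprD addrACA subrr addr0.
- by rewrite ltNge leey/= (cdf_infty cH).
Unshelve. all: by end_near. Qed.

(** The mass that H puts at time 0 is moved to [+oo]; this is the deviation that excludes an atom at
    0 in equilibrium. *)
Definition withdraw H : \bar R -> R :=
  fun t => if (t < 0)%E then 0 else if t == +oo%E then 1 else H t - H 0%E.

Lemma cdf_withdraw H : is_cdf H -> is_cdf (withdraw H).
Proof.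
move=> cH; rewrite /withdraw; split.
- by move=> t ->.
- move=> s t s0 st; rewrite !ltNge s0 (le_trans s0 st)/=.
  case: eqP st => [->|_ st]; first by rewrite leye_eq => ->.
  case: eqP => _; last by rewrite lerB// is_cdf_le.
  by rewrite lerBlDr (le_trans (is_cdf_le1 s cH))// lerDl is_cdf_ge0.
- move=> t t0; rewrite ltNge t0/=; case: eqP => _; first by rewrite ler01 lexx.
  by rewrite subr_ge0 is_cdf_le//= lerBlDr (le_trans (is_cdf_le1 t cH))// lerDl is_cdf_ge0.
- move=> x x0; rewrite lte_fin ltNge x0/=.
  apply: (@cvg_trans _ ((fun y => H y%:E - H 0%E) @ x^'+)); last first.
    by apply: cvgB; [exact: cdf_right_cont|exact: cvg_cst].
  apply: near_eq_cvg; near=> y.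
  by rewrite lte_fin ltNge (ltW (le_lt_trans x0 _))//=; near: y; exact: nbhs_right_gt.
- by rewrite ltNge leey.
Unshelve. all: by end_near. Qed.

Lemma cdf_at0 : is_cdf (fun t : \bar R => if (t < 0)%E then 0 else 1 : R).
Proof.
split.
- by move=> t ->.
- by move=> s t s0 st; rewrite !ltNge s0 (le_trans s0 st).
- by move=> t t0; rewrite ltNge t0/= ler01 lexx.
- move=> x x0; rewrite lte_fin ltNge x0/=; apply: cvg_near_cst; near=> y.
  apply/eqP.
  by rewrite lte_fin ltNge (ltW (le_lt_trans x0 _))//=; near: y; exact: nbhs_right_gt.
- by rewrite ltNge leey.
Unshelve. all: by end_near. Qed.

Lemma cdf_never : is_cdf (fun t : \bar R => (t == +oo%E)%:R : R).
Proof.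
split.
- by move=> t t0; rewrite lt_eqF// (lt_le_trans t0) ?leey.
- by move=> s t s0 st; case: eqP st => [->|_ _]//; rewrite leye_eq => ->.
- by move=> t t0; case: eqP; rewrite lexx ler01.
- by move=> x x0; exact: cvg_cst.
- by rewrite eqxx.
Qed.

End cdf_theory.

(** * The exponential clock of rate r *)

Section discount_cdf.
Context (R : realType) (r : R) (r_gt0 : 0 < r).
Implicit Types (s t : \bar R).

Definition discount_cdf : \bar R -> R :=
  fun t => if (t < 0)%E then 0 else 1 - discount r t.

Lemma discount_ge0 t : 0 <= discount r t.
Proof. by case: t => //= x; exact: expR_ge0. Qed.

Lemma discount_le1 t : (0 <= t)%E -> discount r t <= 1.
Proof.
case: t => //= x; rewrite lee_fin => x0.
by rewrite -expR0 ler_expR oppr_le0 mulr_ge0// ltW.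
Qed.

Lemma discount_nincr s t : (0 <= s)%E -> (s <= t)%E -> discount r t <= discount r s.
Proof.
move: s t => [s| |] [t| |] //=; rewrite ?expR_ge0//.
by rewrite !lee_fin => s0 st; rewrite ler_expR lerN2 ler_pM2l.
Qed.

Lemma continuous_expRN : continuous (fun x : R => expR (- (r * x))).
Proof.
move=> x; apply: continuous_comp; last exact: continuous_expR.
by apply: cvgN; apply: cvgM; [exact: cvg_cst|exact: cvg_id].
Qed.

Lemma cdf_discount : is_cdf discount_cdf.
Proof.
rewrite /discount_cdf; split.
- by move=> t ->.
- move=> s t s0 st; rewrite !ltNge s0 (le_trans s0 st)/=.
  by rewrite lerB// discount_nincr.
- by move=> t t0; rewrite ltNge t0/= subr_ge0 discount_le1//= gerBl discount_ge0.
- move=> x x0; rewrite lte_fin ltNge x0/=.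
  apply: (@cvg_trans _ ((fun y : R => 1 - expR (- (r * y))) @ x^'+)); last first.
    apply: cvgB; first exact: cvg_cst.
    by apply: cvg_at_right_filter; exact: continuous_expRN.
  apply: near_eq_cvg; near=> y.
  by rewrite lte_fin ltNge (ltW (le_lt_trans x0 _))//=; near: y; exact: nbhs_right_gt.
- by rewrite ltNge leey/= subr0.
Unshelve. all: by end_near. Qed.

End discount_cdf.

(** * Laws on the time axis *)

Section cdf_law_theory.
Context (R : realType).
Implicit Types (F G H K : \bar R -> R) (s t : \bar R).

Lemma measurable_setlee t : measurable [set s : \bar R | (s <= t)%E].
Proof.
rewrite (_ : [set _ | _] = `]-oo, t]%classic); first exact: emeasurable_itv.
by apply/seteqP; split => x /=; rewrite in_itv.
Qed.

Lemma measurable_setlte t : measurable [set s : \bar R | (s < t)%E].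
Proof.
rewrite (_ : [set _ | _] = `]-oo, t[%classic); first exact: emeasurable_itv.
by apply/seteqP; split => x /=; rewrite in_itv.
Qed.

Lemma measurable_setgee t : measurable [set s : \bar R | (t <= s)%E].
Proof.
rewrite (_ : [set _ | _] = ~` [set s | (s < t)%E]).
  exact/measurableC/measurable_setlte.
by apply/seteqP; split => x /=; rewrite leNgt => /negP.
Qed.

Lemma measurable_setgte t : measurable [set s : \bar R | (t < s)%E].
Proof.
rewrite (_ : [set _ | _] = ~` [set s | (s <= t)%E]).
  exact/measurableC/measurable_setlee.
by apply/seteqP; split => x /=; rewrite ltNge => /negP.
Qed.

Lemma law_lt0 H : is_cdf H -> cdf_law H [set s | (s < 0)%E] = 0%E.
Proof.
move=> cH; have <- : (~` [set s : \bar R | (0 <= s <= +oo)%E]) = [set s | (s < 0)%E].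
  by apply/seteqP; split => x /=; rewrite leey andbT ltNge => /negP.
rewrite probability_setC; first by rewrite cdf_lawE// (cdf_infty cH) subee.
rewrite (_ : [set _ | _] = [set s | (0%E <= s)%E]); first exact: measurable_setgee.
by apply/seteqP; split => x /=; rewrite leey andbT.
Qed.

Lemma ae_law_ge0 H : is_cdf H -> \forall t \ae cdf_law H, (0 <= t)%E.
Proof.
move=> cH; exists [set s : \bar R | (s < 0)%E]; split.
- exact: measurable_setlte.
- exact: law_lt0.
- by move=> x /= /negP; rewrite ltNge.
Qed.

Lemma law_le H t : is_cdf H -> cdf_law H [set s | (s <= t)%E] = (H t)%:E.
Proof.
move=> cH; have [t0|t0] := ltP t 0%E.
  rewrite (cdf_neg cH)//; apply/eqP; rewrite -measure_le0 -(law_lt0 cH).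
  apply: le_measure; rewrite ?inE; first exact: measurable_setlee.
    exact: measurable_setlte.
  by move=> x /= /le_lt_trans; apply.
rewrite -(cdf_lawE cH t0).
have -> : [set s | (s <= t)%E] = [set s : \bar R | (s < 0)%E] `|` [set s | (0 <= s <= t)%E].
  apply/seteqP; split => x /=.
    by move=> xt; have [x0|x0] := ltP x 0%E; [left|right; rewrite xt].
  by move=> [/ltW /le_trans|/andP[]//]; apply.
have m0t : measurable [set s : \bar R | (0 <= s <= t)%E].
  rewrite (_ : [set _ | _] = [set s | (0%E <= s)%E] `&` [set s | (s <= t)%E]).
    by apply: measurableI; [exact: measurable_setgee|exact: measurable_setlee].
  by apply/seteqP; split => x /= /andP.
rewrite measureU//=; last 2 first.
- exact: measurable_setlte.
- by apply/seteqP; split => x //= -[x0 /andP[]]; rewrite leNgt x0.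
by rewrite (law_lt0 cH) add0e.
Qed.

Lemma law_gt H t : is_cdf H -> cdf_law H [set s | (t < s)%E] = (1 - H t)%:E.
Proof.
move=> cH; rewrite (_ : [set _ | _] = ~` [set s | (s <= t)%E]); last first.
  by apply/seteqP; split => x /=; rewrite ltNge => /negP.
by rewrite probability_setC; [rewrite law_le|exact: measurable_setlee].
Qed.

Lemma measurable_le_section d (T : measurableType d) (f g : T -> \bar R) :
  measurable_fun setT f -> measurable_fun setT g ->
  measurable [set x | (f x <= g x)%E].
Proof. by move=> mf mg; rewrite -[X in measurable X]setTI; exact: measurable_lee. Qed.

(** Measurability comes from the law: H(t) is the mass of the section at t of the measurable set {s
    <= t}. *)
Lemma measurable_cdf H : is_cdf H -> measurable_fun setT H.
Proof.
move=> cH.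
rewrite (_ : H = fine \o (cdf_law H \o xsection [set p : \bar R * \bar R | (p.2 <= p.1)%E])).
  apply: measurableT_comp => //; apply: measurable_fun_xsection.
  exact: measurable_le_section.
apply/funext => t /=; rewrite (_ : xsection _ _ = [set s | (s <= t)%E]) ?law_le//.
by apply/seteqP; split => s /=; rewrite /xsection/= inE.
Qed.

Lemma le_integral_law H (f g : \bar R -> \bar R) : is_cdf H ->
  (forall t, 0 <= f t)%E -> (forall t, 0 <= g t)%E ->
  measurable_fun setT f -> measurable_fun setT g ->
  (forall t, 0 <= t -> f t <= g t)%E ->
  (\int[cdf_law H]_t f t <= \int[cdf_law H]_t g t)%E.
Proof.
move=> cH f0 g0 mf mg fg; apply: ae_ge0_le_integral => //.
by apply: filterS (ae_law_ge0 cH) => t t0 _; exact: fg.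
Qed.

Lemma integral_law_advance (d : R) H (f : \bar R -> \bar R) : 0 <= d -> is_cdf H ->
  (forall t, 0 <= f t)%E -> measurable_fun setT f ->
  (\int[cdf_law (advance d H)]_t f t =
   \int[cdf_law H]_t f (maxe (t - d%:E) 0))%E.
Proof.
move=> d0 cH f0 mf.
pose g t := maxe (t - d%:E)%E 0%E.
have mg : measurable_fun setT g.
  by apply: measurable_maxe => //; exact: emeasurable_funB.
pose X : {mfun \bar R >-> \bar R} := HB.pack g (isMeasurableFun.Build _ _ _ _ g mg).
(* For t >= 0, max(s - d, 0) <= t is equivalent to s <= t + d, so the image law has the advanced
   cdf. *)
have dX A : measurable A -> distribution (cdf_law H) X A = cdf_law (advance d H) A.
  apply: cdf_law_unique; first exact: cdf_advance.
  move=> t t0; rewrite /distribution /pushforward /advance ltNge t0/= -(law_le _ cH).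
  congr (cdf_law H _); apply/seteqP; split => s /=.
    by rewrite /g => /andP[_]; rewrite ge_max leeBlDr// => /andP[].
  by move=> std; rewrite /g le_max lexx orbT ge_max t0 leeBlDr//= std.
rewrite (eq_measure_integral (distribution (cdf_law H) X)); last first.
  by move=> A mA _; exact/esym/dX.
by rewrite ge0_integral_distribution.
Qed.

(** The convex combination of the two laws has the mixed cdf, and a law is determined by its cdf.
    This makes the expected prize affine in a firm's own strategy. *)
Lemma integral_law_mixture (e : R) H K (f : \bar R -> \bar R) : 0 <= e <= 1 ->
  is_cdf H -> is_cdf K -> (forall t, 0 <= f t)%E -> measurable_fun setT f ->
  (\int[cdf_law (mixture e H K)]_t f t =
   (1 - e)%:E * \int[cdf_law H]_t f t + e%:E * \int[cdf_law K]_t f t)%E.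
Proof.
move=> e01 cH cK f0 mf; have /andP[e0 e1] := e01.
have e1' : 0 <= 1 - e by rewrite subr_ge0.
pose P : {measure set (\bar R) -> \bar R} :=
  measure_add (mscale (NngNum e1') (cdf_law H)) (mscale (NngNum e0) (cdf_law K)).
have PT : P setT = 1%E.
  rewrite [LHS]measure_addE; apply: (@etrans _ _ ((1 - e)%:E * 1 + e%:E * 1)%E).
    by congr (_ * _ + _ * _)%E; exact: probability_setT.
  by rewrite !mule1 -EFinD subrK.
pose P' : probability (\bar R) R := HB.pack (Measure.sort P)
  (Measure_isProbability.Build _ _ _ P PT).
have PE A : measurable A -> P' A = cdf_law (mixture e H K) A.
  apply: cdf_law_unique; first exact: cdf_mixture.
  move=> t t0; by rewrite [LHS]measure_addE EFinD !EFinM -(cdf_lawE cH t0) -(cdf_lawE cK t0).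
transitivity (\int[P]_t f t)%E.
  by apply: eq_measure_integral => A mA _; exact/esym/PE.
by rewrite ge0_integral_measure_add// !ge0_integral_mscale.
Qed.

End cdf_law_theory.

Section discount_law.
Context (R : realType) (r : R) (r_gt0 : 0 < r).
Let L := cdf_law (discount_cdf r).

(** The open tail is given by [law_gt]. The closed tail has the same mass because the clock has no
    atoms: V is left-continuous at positive finite times and tends to 0 at [+oo]. *)
Lemma discount_law_ge (t : \bar R) : (0 <= t)%E ->
  L [set s | (t <= s)%E] = (discount r t)%:E.
Proof.
move=> t0; have cX := cdf_discount r_gt0.
have Lgt s : (0 <= s)%E -> L [set u | (s < u)%E] = (discount r s)%:E.
  by move=> s0; rewrite law_gt// /discount_cdf ltNge s0/= opprB addrC subrK.
have Lge s u : (0 <= s)%E -> (s < u)%E ->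
    (L [set v | (u <= v)%E] <= (discount r s)%:E)%E.
  move=> s0 su; rewrite -Lgt//; apply: le_measure; rewrite ?inE.
  - exact: measurable_setgee.
  - exact: measurable_setgte.
  - by move=> x /=; exact: lt_le_trans.
apply/eqP; rewrite eq_le; apply/andP; split; last first.
  rewrite -Lgt//; apply: le_measure; rewrite ?inE.
  - exact: measurable_setgte.
  - exact: measurable_setgee.
  - by move=> x /= /ltW.
have Lfin s : L [set u | (s <= u)%E] \is a fin_num.
  by rewrite fin_num_measure//; exact: measurable_setgee.
rewrite -(fineK (Lfin t)) lee_fin.
case: t t0 => [x x0| _|//].
- move: x0; rewrite lee_fin le_eqVlt => /predU1P[<-|x0].
    by rewrite /= mulr0 oppr0 expR0 -lee_fin fineK// probability_le1//; exact: measurable_setgee.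
  (* The closed tail at x is at most V(y) for every y < x near x, and V(y) tends to V(x). *)
  have cv : discount r y%:E @[y --> x^'-] --> discount r x%:E.
    by apply: cvg_at_left_filter; exact: continuous_expRN.
  rewrite -(cvg_lim _ cv)//; apply: limr_ge; first by apply/cvg_ex; exists (discount r x%:E).
  near=> y; rewrite -lee_fin fineK//; apply: Lge; last by rewrite lte_fin.
  by rewrite lee_fin; apply: ltW; near: y; exact: nbhs_left_gt.
- apply/ler_addgt0Pr => e e0; rewrite add0r.
  (* At the time 1/(re) the discount is exp(-1/e), which is at most e because 1 + 1/e <=
     exp(1/e). *)
  have re0 : 0 < (r * e)^-1 by rewrite invr_gt0 mulr_gt0.
  rewrite -lee_fin fineK//.
  apply: (le_trans (Lge (r * e)^-1%:E _ _ _)); rewrite ?ltry ?lee_fin ?(ltW re0)//=.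
  rewrite invfM mulrA mulfV ?gt_eqF// mul1r expRN -[leRHS]invrK.
  rewrite lef_pV2 ?posrE ?expR_gt0 ?invr_gt0//.
  by apply: le_trans (expR_ge1Dx _); rewrite lerDr.
Unshelve. all: by end_near. Qed.

End discount_law.

(** * Independent draws *)

Section product_law_theory.
Context d (T : measurableType d) (R : realType).
Local Open Scope ereal_scope.

Lemma integral_product_law n (P : 'I_n.+1 -> probability T R) (f : n.+1.-tuple T -> \bar R) :
  (forall u, 0 <= f u) -> measurable_fun setT f ->
  \int[product_law P]_u f u =
  \int[P ord0]_x \int[product_law (fun i => P (lift ord0 i))]_u f (tcons (x, u)).
Proof.
move=> f0 mf; rewrite ge0_integral_distribution// fubini_tonelli1//; last by move=> x; exact: f0.
by apply: measurableT_comp => //; exact: measurable_tcons.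
Qed.

Lemma measurable_integral_tcons n (P : probability (n.-tuple T) R)
    (f : n.+1.-tuple T -> \bar R) :
  (forall u, 0 <= f u) -> measurable_fun setT f ->
  measurable_fun setT (fun x => \int[P]_u f (tcons (x, u))).
Proof.
move=> f0 mf.
apply: (@measurable_fun_fubini_tonelli_F _ _ _ _ _ P (f \o (@tcons _ T n))) => //;
  last by move=> x; exact: f0.
by apply: measurableT_comp => //; exact: measurable_tcons.
Qed.

Lemma measurable_tupleE n :
  measurable = <<s [set B : set (n.-tuple T) | exists A : 'I_n -> set T,
    (forall i, measurable (A i)) /\ B = [set u | forall i, A i (tnth u i)]] >>.
Proof.
apply/seteqP; split; last first.
  apply: smallest_sub; first exact: sigma_algebra_measurable.
  by move=> B [A [mA ->]]; exact: measurable_box.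
apply: smallest_sub; first exact: smallest_sigma_algebra.
move=> B; rewrite -bigcup_seq => -[i _ [A mA <-]].
(* A cylinder over coordinate i is a box whose other sides are full, so boxes generate the product
   sigma-algebra. *)
apply: sub_sigma_algebra; exists (fun j => if j == i then A else setT); split.
  by move=> j; case: ifP.
apply/seteqP; split => u /=.
  by move=> [_ Au] j; case: eqP => // ->.
by move=> /(_ i); rewrite eqxx.
Qed.

Lemma tuple_measure_unique n (P Q : probability (n.-tuple T) R) :
  (forall A : 'I_n -> set T, (forall i, measurable (A i)) ->
    P [set u | forall i, A i (tnth u i)] = Q [set u | forall i, A i (tnth u i)]) ->
  forall B, measurable B -> P B = Q B.
Proof.
move=> PQ; apply: (measure_unique _ (fun=> setT) (measurable_tupleE n)).
- move=> _ _ [A [mA ->]] [A' [mA' ->]]; exists (fun i => A i `&` A' i); split.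
    by move=> i; exact: measurableI.
  apply/seteqP; split => u /=; first by move=> [Au A'u] i; split.
  by move=> AA'u; split => i; have [] := AA'u i.
- by move=> _; exists (fun=> setT); split => //; apply/seteqP; split.
- by rewrite bigcup_const//; exists 0%N.
- by move=> _ [A [mA ->]]; exact: PQ.
- by move=> _; rewrite /= -ge0_fin_numE// fin_num_measure.
Qed.

Definition permute n (s : 'I_n -> 'I_n) (u : n.-tuple T) : n.-tuple T :=
  [tuple tnth u (s i) | i < n].

Lemma measurable_permute n (s : 'I_n -> 'I_n) : measurable_fun setT (permute s).
Proof.
apply/measurable_fun_tnthP => i.
rewrite (_ : _ \o _ = (@tnth _ T)^~ (s i)); first exact: measurable_tnth.
by apply/funext => u /=; rewrite tnth_mktuple.
Qed.

(** On a box, permuting the coordinates permutes the factors of the product. For an involution the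
    permuted sides are again indexed by [s]; exchangeability of the firms only calls for
    transpositions. *)
Lemma integral_product_law_permute n (P : probability T R) (s : 'I_n -> 'I_n)
    (sK : involutive s) (f : n.-tuple T -> \bar R) :
  (forall u, 0 <= f u) -> measurable_fun setT f ->
  \int[product_law (fun=> P)]_u f (permute s u) = \int[product_law (fun=> P)]_u f u.
Proof.
move=> f0 mf.
pose X : {mfun n.-tuple T >-> n.-tuple T} :=
  HB.pack (permute s) (isMeasurableFun.Build _ _ _ _ _ (measurable_permute s)).
transitivity (\int[distribution (product_law (fun=> P)) X]_u f u).
  by rewrite ge0_integral_distribution.
apply: eq_measure_integral => B mB _.
apply: tuple_measure_unique mB => A mA.
transitivity (product_law (fun=> P) [set u | forall i, A (s i) (tnth u i)]); last first.
  rewrite product_lawE// (@product_lawE _ _ _ _ _ (fun i => A (s i)))//.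
  by rewrite [RHS](reindex_inj (inv_inj sK)).
congr (product_law _ _); apply/seteqP; split => u /= Au i.
  by have := Au (s i); rewrite tnth_mktuple sK.
by rewrite tnth_mktuple; have := Au (s i); rewrite sK.
Qed.

End product_law_theory.

(** * The first breakthrough time *)

Section first_time.
Context (R : realType) (n : nat).
Implicit Types (u : n.-tuple (\bar R)) (t : \bar R).

Definition first_time u : \bar R := \big[Order.min/+oo%E]_(j < n) tnth u j.

Lemma first_time_geP t u : (t <= first_time u)%E <-> forall i, (t <= tnth u i)%E.
Proof.
split=> [/bigmin_geP[_ h] i|h]; first exact: h.
by apply/bigmin_geP; split => //; rewrite leey.
Qed.

Lemma first_time_le u i : (first_time u <= tnth u i)%E.
Proof. by move: i; apply/first_time_geP. Qed.

(** The empty tuple is excluded because its minimum is the default [+oo], which does not exceed t =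
    [+oo]. *)
Lemma first_time_gtP t u : (0 < n)%N ->
  (t < first_time u)%E <-> forall i, (t < tnth u i)%E.
Proof.
move=> n0; split=> [/bigmin_gtP[_ h] i|h]; first exact: h.
apply/bigmin_gtP; split => //; apply: lt_le_trans (h (Ordinal n0)) _.
by rewrite leey.
Qed.

Lemma first_time_attained u : (0 < n)%N -> exists i, tnth u i = first_time u.
Proof.
move=> n0; have le_oo i : predT i -> (tnth u i <= +oo)%E by rewrite leey.
by have [i _ ui] := @eq_bigmin _ _ _ +oo%E (Ordinal n0) predT _ isT le_oo; exists i.
Qed.

Lemma measurable_first_time : measurable_fun setT first_time.
Proof.
rewrite /first_time; elim: (index_enum _) => [|j l IHl].
  by under eq_fun do rewrite big_nil; exact: measurable_cst.
under eq_fun do rewrite big_cons.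
by apply: measurable_mine => //; exact: measurable_tnth.
Qed.

Lemma measurable_first_time_le t : measurable [set u | (first_time u <= t)%E].
Proof.
by apply: measurable_le_section; [exact: measurable_first_time|exact: measurable_cst].
Qed.

Lemma measurable_first_time_ge t : measurable [set u | (t <= first_time u)%E].
Proof.
by apply: measurable_le_section; [exact: measurable_cst|exact: measurable_first_time].
Qed.

Lemma first_time_gtC t :
  [set u | (t < first_time u)%E] = ~` [set u | (first_time u <= t)%E].
Proof. by apply/seteqP; split => u /=; rewrite ltNge => /negP. Qed.

Lemma measurable_first_time_gt t : measurable [set u | (t < first_time u)%E].
Proof. by rewrite first_time_gtC; exact: measurableC (measurable_first_time_le t). Qed.

Lemma product_law_ge (P : 'I_n -> probability (\bar R) R) t :
  (product_law P [set u | (t <= first_time u)%E] = \prod_i P i [set s | (t <= s)%E])%E.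
Proof.
rewrite -product_lawE; last by move=> i; exact: measurable_setgee.
by congr (product_law P _); apply/seteqP; split => u /= /first_time_geP; apply.
Qed.

Lemma product_law_gt (P : 'I_n -> probability (\bar R) R) t : (0 < n)%N ->
  (product_law P [set u | (t < first_time u)%E] = \prod_i P i [set s | (t < s)%E])%E.
Proof.
move=> n0; rewrite -product_lawE; last by move=> i; exact: measurable_setgte.
by congr (product_law P _); apply/seteqP; split => u /= /(first_time_gtP _ _ n0).
Qed.

End first_time.

(** * Gross payoffs *)

Section gross_payoff_theory.
Context (R : realType) (r : R) (r_gt0 : 0 < r) (n : nat).
Implicit Types (u : n.-tuple (\bar R)) (i j : 'I_n).

Lemma measurable_discount : measurable_fun [set: \bar R] (discount r).
Proof.
rewrite (_ : discount r = fun t => if t == +oo%E then 0 else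
    if t == -oo%E then 0 else expR (- (r * fine t))); last by apply/funext => -[].
apply: measurable_fun_ifT; [exact: measurable_fun_eqe|exact: measurable_cst|].
apply: measurable_fun_ifT; [exact: measurable_fun_eqe|exact: measurable_cst|].
apply: measurableT_comp => //; apply: measurableT_comp => //.
by apply: measurable_funM => //; exact: measurable_cst.
Qed.

Lemma gross_payoff_ge0 i u : 0 <= gross_payoff r i u.
Proof.
by rewrite /gross_payoff; case: ifP => // _; rewrite divr_ge0// discount_ge0.
Qed.

Lemma measurable_gross_payoff i : measurable_fun setT (gross_payoff r i).
Proof.
have meq j : measurable_fun [set: n.-tuple (\bar R)]
    (fun u => tnth u j == first_time u).
  by apply: measurable_fun_eqe; [exact: measurable_tnth|exact: measurable_first_time].
apply: measurable_fun_ifT; [exact: meq| |exact: measurable_cst].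
apply: measurable_funM.
  by apply: measurableT_comp; [exact: measurable_discount|exact: measurable_first_time].
(* The inverse of the number of tied firms is written as the power -1 of a sum of indicators, which
   is visibly measurable. *)
rewrite (_ : (fun _ => _) = fun u =>
    (\sum_(j < n) (if tnth u j == first_time u then 1 else 0)) `^ (-1)); last first.
  apply/funext => u; rewrite -big_mkcond/= sumr_const powR_inv1 ?ler0n//.
apply: (@measurableT_comp _ _ _ _ _ _ (@powR R ^~ (-1))) => //.
apply: measurable_sum => j.
by apply: measurable_fun_ifT; [exact: meq|exact: measurable_cst|exact: measurable_cst].
Qed.

Lemma gross_payoff_le_discount i u :
  gross_payoff r i u <= if (tnth u i <= first_time u)%E then discount r (tnth u i) else 0.
Proof.
rewrite /gross_payoff -/(first_time u); case: eqVneq => [e|ne]; last first.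
  by case: ifP => // _; exact: discount_ge0.
rewrite e lexx ler_pdivrMr ?ltr0n; last by apply/card_gt0P; exists i; rewrite inE e.
rewrite ler_peMr ?discount_ge0// ler1n; apply/card_gt0P.
by exists i; rewrite inE e.
Qed.

Lemma gross_payoff_first i u : (forall j, j != i -> (tnth u i < tnth u j)%E) ->
  gross_payoff r i u = discount r (tnth u i).
Proof.
move=> iu; have e : first_time u = tnth u i.
  apply/eqP; rewrite eq_le first_time_le; apply/first_time_geP => j.
  by case: (eqVneq j i) => [->//|/iu/ltW].
rewrite /gross_payoff -/(first_time u) e eqxx.
rewrite (_ : #|_| = 1%N) ?divr1//; rewrite -(card1 i); apply: eq_card => j.
rewrite !inE; case: (eqVneq j i) => [->|/iu ij]; first by rewrite eqxx.
by rewrite gt_eqF.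
Qed.

Lemma sum_gross_payoff u : (0 < n)%N ->
  \sum_i gross_payoff r i u = discount r (first_time u).
Proof.
move=> n0; rewrite /gross_payoff -/(first_time u) -big_mkcond/= sumr_const.
set k := #|[pred j : 'I_n | tnth u j == first_time u]|.
transitivity (discount r (first_time u) / k%:R *+ k); first by [].
rewrite -mulr_natr -mulrA mulVf ?mulr1// pnatr_eq0 -lt0n.
by have [i ui] := first_time_attained u n0; apply/card_gt0P; exists i; rewrite inE ui.
Qed.

Lemma first_time_permute (s : 'I_n -> 'I_n) u : involutive s ->
  first_time (permute s u) = first_time u.
Proof.
move=> sK; apply/eqP; rewrite eq_le; apply/andP; split; apply/first_time_geP => i.
  by have := first_time_le (permute s u) (s i); rewrite tnth_mktuple sK.
by rewrite tnth_mktuple first_time_le.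
Qed.

Lemma gross_payoff_permute (s : 'I_n -> 'I_n) i u : involutive s ->
  gross_payoff r i (permute s u) = gross_payoff r (s i) u.
Proof.
move=> sK; rewrite /gross_payoff -!/(first_time _) first_time_permute// tnth_mktuple.
case: ifP => // _; congr (_ / _%:R).
rewrite -[RHS](card_imset _ (inv_inj sK)); apply: eq_card => j.
rewrite !inE tnth_mktuple; apply/idP/imsetP.
  by move=> sj; exists (s j); rewrite ?inE// sK.
by move=> [k]; rewrite inE => kf ->; rewrite sK.
Qed.

(** A transposition of two firms preserves the i.i.d. law and exchanges their payoffs, so all firms
    expect the same amount, and the tie shares add up to the whole prize. *)
Lemma integral_gross_payoff_iid (P : probability (\bar R) R) i :
  (n%:R%:E * \int[product_law (fun _ : 'I_n => P)]_u (gross_payoff r i u)%:E =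
   \int[product_law (fun _ : 'I_n => P)]_u (discount r (first_time u))%:E)%E.
Proof.
have n0 : (0 < n)%N by case: n i => // -[].
have E j : (\int[product_law (fun _ : 'I_n => P)]_u (gross_payoff r j u)%:E =
            \int[product_law (fun _ : 'I_n => P)]_u (gross_payoff r i u)%:E)%E.
  have tK : involutive (tperm i j) := @tpermK _ i j.
  rewrite -(integral_product_law_permute P tK); last 2 first.
  - by move=> u; rewrite lee_fin gross_payoff_ge0.
  - by apply/measurable_EFinP; exact: measurable_gross_payoff.
  by apply: eq_integral => u _; rewrite gross_payoff_permute// tpermR.
under [RHS]eq_integral do rewrite -sum_gross_payoff// -sumEFin.
rewrite ge0_integral_sum//; last 2 first.
- by move=> j; apply/measurable_EFinP; exact: measurable_gross_payoff.
- by move=> j u _; rewrite lee_fin gross_payoff_ge0.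
under [RHS]eq_bigr do rewrite E.
by rewrite sumr_const card_ord mule_natl.
Qed.

End gross_payoff_theory.

(** * One firm against i.i.d. rivals *)

Section against.
Context (R : realType) (r : R) (r_gt0 : 0 < r) (n : nat).
Implicit Types (u : n.-tuple (\bar R)) (F H K : \bar R -> R).

Lemma tnth_tcons0 (t : \bar R) u : tnth (tcons (t, u)) ord0 = t.
Proof. by []. Qed.

Lemma tnth_tconsS (t : \bar R) u i : tnth (tcons (t, u)) (lift ord0 i) = tnth u i.
Proof. by rewrite tnthS. Qed.

(** Coordinate 0 is the firm under study, with its time frozen at t; here [n] counts its rivals. *)
Definition prize_against F (t : \bar R) : \bar R :=
  (\int[product_law (fun _ : 'I_n => cdf_law F)]_u (gross_payoff r ord0 (tcons (t, u)))%:E)%E.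

Let mgross : measurable_fun setT (fun u : n.+1.-tuple (\bar R) => (gross_payoff r ord0 u)%:E).
Proof. by apply/measurable_EFinP; exact: measurable_gross_payoff. Qed.

Let mgross_tcons t :
  measurable_fun setT (fun u => (gross_payoff r ord0 (tcons (t, u)))%:E).
Proof.
apply: (measurableT_comp mgross).
by apply: (measurableT_comp (@measurable_tcons _ _ n)); exact: pair1_measurable.
Qed.

Lemma prize_against_ge0 F t : (0 <= prize_against F t)%E.
Proof. by apply: integral_ge0 => u _; rewrite lee_fin gross_payoff_ge0. Qed.

Lemma measurable_prize_against F : measurable_fun setT (prize_against F).
Proof.
apply: (measurable_integral_tcons (product_law (fun _ : 'I_n => cdf_law F)) _ mgross).
by move=> u; rewrite lee_fin gross_payoff_ge0.
Qed.

Lemma integral_gross_payoff_against H F :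
  (\int[product_law (fun j => cdf_law (deviation (ord0 : 'I_n.+1) H F j))]_u
     (gross_payoff r ord0 u)%:E = \int[cdf_law H]_t prize_against F t)%E.
Proof.
by rewrite integral_product_law// => u; rewrite lee_fin gross_payoff_ge0.
Qed.

(** A positive payoff requires that no rival is strictly earlier, and a tie share is at most the
    full prize. *)
Lemma prize_against_le F t :
  (prize_against F t <= (discount r t)%:E * cdf_law F [set s | (t <= s)%E] ^+ n)%E.
Proof.
have -> : (cdf_law F [set s | (t <= s)%E] ^+ n =
    product_law (fun _ : 'I_n => cdf_law F) [set u | (t <= first_time u)%E])%E.
  by rewrite product_law_ge big_const_ord iter_mule mule1.
have mt := measurable_first_time_ge (n := n) t.
rewrite -(setIT [set u : n.-tuple _ | (t <= first_time u)%E]) -integral_indic//.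
rewrite -ge0_integralZl//; last 2 first.
- exact/measurable_EFinP/measurable_indic.
- by rewrite lee_fin discount_ge0.
apply: ge0_le_integral => //.
- by move=> u _; rewrite lee_fin gross_payoff_ge0.
- by apply/measurable_EFinP; apply: measurable_funM => //; exact: measurable_indic.
- move=> u _; rewrite -EFinM lee_fin (le_trans (gross_payoff_le_discount _ _ _))//.
  rewrite tnth_tcons0; case: ifP => [tu|_]; last by rewrite mulr_ge0// discount_ge0.
  rewrite indicE mem_set ?mulr1//=; apply/first_time_geP => i.
  by rewrite -(tnth_tconsS t); move: (lift _ _); apply/first_time_geP.
Qed.

(** When all rivals are strictly later the prize is won undivided. The gap to [prize_against_le]
    comes from ties only. *)
Lemma prize_against_ge F t : (0 < n)%N ->
  ((discount r t)%:E * cdf_law F [set s | (t < s)%E] ^+ n <= prize_against F t)%E.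
Proof.
move=> n0.
have -> : (cdf_law F [set s | (t < s)%E] ^+ n =
    product_law (fun _ : 'I_n => cdf_law F) [set u | (t < first_time u)%E])%E.
  by rewrite product_law_gt// big_const_ord iter_mule mule1.
have mt := measurable_first_time_gt (n := n) t.
rewrite -(setIT [set u : n.-tuple _ | (t < first_time u)%E]) -integral_indic//.
rewrite -ge0_integralZl//; last 2 first.
- exact/measurable_EFinP/measurable_indic.
- by rewrite lee_fin discount_ge0.
apply: ge0_le_integral => //.
- by move=> u _; rewrite -EFinM lee_fin mulr_ge0// discount_ge0.
- by apply/measurable_EFinP; apply: measurable_funM => //; exact: measurable_indic.
- move=> u _; rewrite -EFinM lee_fin indicE.
  have [/set_mem/= tu|_] := boolP (u \in _); last by rewrite mulr0 gross_payoff_ge0.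
  rewrite mulr1 gross_payoff_first// => j.
  case: (unliftP ord0 j) => [k ->|->]; last by rewrite eqxx.
  by rewrite tnth_tconsS tnth_tcons0 => _; move: k; apply/first_time_gtP.
Qed.

End against.

(** * Differences of powers *)

Section power_bounds.
Context (R : realFieldType).
Implicit Types (a b : R).

Lemma exprB_le1 a b k : 0 <= b -> b <= a -> a <= 1 ->
  a ^+ k - b ^+ k <= k%:R * (a - b).
Proof.
move=> b0 ba a1; elim: k => [|k IHk]; first by rewrite !expr0 subrr mul0r.
have a0 := le_trans b0 ba.
have -> : a ^+ k.+1 - b ^+ k.+1 = a * (a ^+ k - b ^+ k) + (a - b) * b ^+ k.
  by rewrite !exprS mulrBr mulrBl addrA subrK.
have h1 : a * (a ^+ k - b ^+ k) <= k%:R * (a - b).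
  by apply: le_trans IHk; rewrite ler_piMl// subr_ge0 lerXn2r.
have h2 : (a - b) * b ^+ k <= a - b.
  by rewrite ler_piMr ?subr_ge0// exprn_ile1// (le_trans ba).
by rewrite -natr1 [leRHS]mulrDl mul1r lerD.
Qed.

Lemma exprSB_le a b k : 0 <= b -> b <= a ->
  a ^+ k.+1 - b ^+ k.+1 <= k.+1%:R * (a - b) * a ^+ k.
Proof.
move=> b0 ba; have a0 := le_trans b0 ba.
elim: k => [|k IHk]; first by rewrite !expr1 expr0 mulr1n mul1r mulr1.
have -> : a ^+ k.+2 - b ^+ k.+2 = a * (a ^+ k.+1 - b ^+ k.+1) + (a - b) * b ^+ k.+1.
  by rewrite !(exprS _ k.+1); ring.
have -> : k.+2%:R * (a - b) * a ^+ k.+1 =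
    a * (k.+1%:R * (a - b) * a ^+ k) + (a - b) * a ^+ k.+1.
  by rewrite -natr1 exprS; ring.
by rewrite lerD// ler_wpM2l ?subr_ge0// lerXn2r.
Qed.

(** The mean value bound has slope [a ^+ k]; replacing it by the slope at b costs at most k(a - b),
    so the error is quadratic in a - b. In the planner's problem b is the survival function of the
    optimum and a that of its perturbation. *)
Lemma exprSB_le_quadratic a b k : 0 <= b -> b <= a -> a <= 1 ->
  a ^+ k.+1 - b ^+ k.+1 <= k.+1%:R * (a - b) * (b ^+ k + k%:R * (a - b)).
Proof.
move=> b0 ba a1; apply: (le_trans (exprSB_le k b0 ba)).
rewrite ler_wpM2l ?mulr_ge0 ?subr_ge0//.
by rewrite -lerBlDl exprB_le1.
Qed.

End power_bounds.

(** * Expectations and Tonelli exchanges *)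

Section probability_integrals.
Context d (T : measurableType d) (R : realType) (P : probability T R).

Lemma integrable_prob_bounded (f : T -> R) (M : R) : measurable_fun setT f ->
  (forall x, `|f x| <= M) -> P.-integrable setT (EFin \o f).
Proof.
move=> mf fM; apply: measurable_bounded_integrable => //.
  by rewrite (le_lt_trans (probability_le1 P measurableT))// ltry.
by exists M; split; [exact: num_real|move=> x Mx y _; exact: le_trans (fM y) (ltW Mx)].
Qed.

Lemma integral_section d' (T' : measurableType d') (Q : probability T' R)
    (A : set (T * T')) : measurable A ->
  (\int[P]_x Q [set y | A (x, y)] = \int[Q]_y P [set x | A (x, y)])%E.
Proof.
move=> mA; have /= H := @fubini_tonelli _ _ _ _ _ P Q (fun z => (\1_A z)%:E).
have mxA x : measurable [set y | A (x, y)].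
  rewrite (_ : [set y | _] = xsection A x); first exact: measurable_xsection.
  by apply/seteqP; split => y /=; rewrite /xsection/= inE.
have myA y : measurable [set x | A (x, y)].
  rewrite (_ : [set x | _] = ysection A y); first exact: measurable_ysection.
  by apply/seteqP; split => x /=; rewrite /ysection/= inE.
transitivity (\int[P]_x \int[Q]_y (\1_A (x, y))%:E)%E.
  apply: eq_integral => x _; rewrite -[X in Q X]setIT -integral_indic//.
rewrite H//; last exact/measurable_EFinP/measurable_indic.
by apply: eq_integral => y _; rewrite -[X in _ = P X]setIT -integral_indic//.
Qed.

Lemma measurable_prob_ge (g : T -> \bar R) : measurable_fun setT g ->
  measurable_fun setT (fun t : \bar R => P [set x | (t <= g x)%E]).
Proof.
move=> mg.
rewrite (_ : (fun _ => _) = P \o xsection [set p : \bar R * T | (p.1 <= g p.2)%E]).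
  apply: measurable_fun_xsection; apply: measurable_le_section => //.
  exact: measurableT_comp.
apply/funext => t /=; congr (P _).
by apply/seteqP; split => x /=; rewrite /xsection/= inE.
Qed.

(** H(g(x)) is the dH-mass of the times up to g(x), so the expectation is a double integral of an
    indicator and the order can be exchanged. *)
Lemma integral_cdf_comp H (g : T -> \bar R) : is_cdf H -> measurable_fun setT g ->
  (\int[P]_x (H (g x))%:E = \int[cdf_law H]_t P [set x | (t <= g x)%E])%E.
Proof.
move=> cH mg; under eq_integral do rewrite -(law_le _ cH).
rewrite (@integral_section _ _ _ [set p : T * \bar R | (p.2 <= g p.1)%E])//.
by apply: measurable_le_section => //; exact: measurableT_comp.
Qed.

End probability_integrals.

(** * Prizes seen from the clock and the rivals *)

Section race.
Context (R : realType) (r : R) (r_gt0 : 0 < r) (n : nat) (n_gt0 : (0 < n)%N).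
Implicit Types (F G H K : \bar R -> R) (t : \bar R).

Let cX : is_cdf (discount_cdf r) := cdf_discount r_gt0.
Local Notation L := (cdf_law (discount_cdf r)).

(* Coordinate 0 is the exponential clock, the others are the rivals. *)
Definition discounted_rivals F : probability (n.+1.-tuple (\bar R)) R :=
  product_law (fun j => cdf_law (deviation (ord0 : 'I_n.+1) (discount_cdf r) F j)).

(** For a cdf H this is the expected prize if every tie were won outright, as [integral_cdf_comp]
    and [discounted_rivals_ge] show. H may be any function, so that the formula also applies to a
    difference of cdfs. *)
Definition fair_prize F H : \bar R :=
  (\int[discounted_rivals F]_u (H (first_time u))%:E)%E.

Lemma discounted_rivals_ge F t : (0 <= t)%E ->
  discounted_rivals F [set u | (t <= first_time u)%E] =
  ((discount r t)%:E * cdf_law F [set s | (t <= s)%E] ^+ n)%E.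
Proof.
move=> t0; rewrite product_law_ge big_ord_recl/= -discount_law_ge//; congr (_ * _)%E.
rewrite (eq_bigr (fun=> cdf_law F [set s | (t <= s)%E]))//.
by rewrite big_const_ord iter_mule mule1.
Qed.

Lemma measurable_discounted_rivals_ge F :
  measurable_fun setT (fun t => discounted_rivals F [set u | (t <= first_time u)%E]).
Proof. by apply: measurable_prob_ge; exact: measurable_first_time. Qed.

Lemma integral_prize_against_le F H : is_cdf H ->
  (\int[cdf_law H]_t prize_against r n F t <= fair_prize F H)%E.
Proof.
move=> cH; rewrite /fair_prize (integral_cdf_comp _ cH); last exact: measurable_first_time.
apply: le_integral_law => //.
- by move=> t; exact: prize_against_ge0.
- exact: measurable_prize_against.
- exact: measurable_discounted_rivals_ge.
- by move=> t t0; rewrite discounted_rivals_ge// prize_against_le.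
Qed.

(* Breaking through [d] earlier turns ties with the rivals into wins. *)
Lemma integral_prize_against_advance F H (d : R) : is_cdf F -> F 0%E = 0 ->
  is_cdf H -> 0 < d ->
  (fair_prize F H <= \int[cdf_law (advance d H)]_t prize_against r n F t)%E.
Proof.
move=> cF F0 cH d0; rewrite /fair_prize (integral_cdf_comp _ cH); last exact: measurable_first_time.
rewrite integral_law_advance//; last 3 first.
- exact: ltW.
- by move=> t; exact: prize_against_ge0.
- exact: measurable_prize_against.
apply: le_integral_law => //.
- by move=> t; exact: prize_against_ge0.
- exact: measurable_discounted_rivals_ge.
- apply: (measurableT_comp (measurable_prize_against _ _ _)).
  by apply: measurable_maxe => //; exact: emeasurable_funB.
move=> t t0; rewrite discounted_rivals_ge//.
case: t t0 => [t| |//] t0; last by rewrite mul0e prize_against_ge0.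
apply: le_trans (prize_against_ge _ _ _ n_gt0).
(* Here s is the advanced entry time. It is no later than t, hence discounted less, and it is
   strictly before t when t > 0, so that a rival at t or later is strictly beaten. *)
set s := maxe _ _.
have s0 : (0 <= s)%E by rewrite le_max lexx orbT.
have st : (s <= t%:E)%E by rewrite ge_max t0 andbT -EFinB lee_fin gerBl ltW.
apply: lee_pmul; rewrite ?expe_ge0// ?lee_fin ?discount_ge0//.
  exact: discount_nincr.
have -> : (cdf_law F [set x | (s < x)%E] ^+ n = (fine (cdf_law F [set x | (s < x)%E]) ^+ n)%:E)%E.
  by rewrite EFin_expe fineK// fin_num_measure//; exact: measurable_setgte.
rewrite -[X in (X ^+ n <= _)%E]fineK; last by rewrite fin_num_measure//; exact: measurable_setgee.
rewrite -EFin_expe lee_fin lerXn2r// ?nnegrE ?fine_ge0//.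
rewrite fine_le// ?fin_num_measure//; [exact: measurable_setgee|exact: measurable_setgte|].
(* Time 0 cannot be advanced; there [F0] ensures that the rivals are almost surely strictly
   later. *)
move: t0; rewrite le_eqVlt => /predU1P[t0|t0].
  have -> : s = 0%E by rewrite /s -t0 sub0e; apply/max_idPr; rewrite leeNl oppe0 lee_fin ltW.
  by rewrite law_gt// F0 subr0 probability_le1//; exact: measurable_setgee.
apply: le_measure; rewrite ?inE; [exact: measurable_setgee|exact: measurable_setgte|].
move=> x /= tx; apply: lt_le_trans tx.
by rewrite gt_max t0 andbT -EFinB lte_fin gtrBl.
Qed.

(** Condition on the clock s: with probability (1 - F(s))^n all rivals come after it, and then the
    first time is s itself. The other outcomes contribute nonnegatively since D >= 0. *)
Lemma fair_prize_gain F (D : \bar R -> R) : is_cdf F -> (forall t, 0 <= D t) ->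
  measurable_fun setT D ->
  (\int[L]_s (D s * (1 - F s) ^+ n)%:E <= fair_prize F D)%E.
Proof.
move=> cF D0 mD; rewrite /fair_prize integral_product_law; last 2 first.
- by move=> u; rewrite lee_fin.
- by apply/measurable_EFinP; apply: measurableT_comp => //; exact: measurable_first_time.
apply: ge0_le_integral => //.
- by move=> s _; rewrite lee_fin mulr_ge0// exprn_ge0// subr_ge0 is_cdf_le1.
- apply/measurable_EFinP; apply: measurable_funM => //.
  by apply: measurable_funX; apply: measurable_funB => //; exact: measurable_cdf.
- apply: (@measurable_integral_tcons _ _ _ _ _ (fun u => (D (first_time u))%:E)).
    by move=> u; rewrite lee_fin.
  by apply/measurable_EFinP; apply: measurableT_comp => //; exact: measurable_first_time.
move=> s _.
pose Q := product_law (fun _ : 'I_n => cdf_law F).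
change ((D s * (1 - F s) ^+ n)%:E <= \int[Q]_u (D (first_time (tcons (s, u))))%:E)%E.
have mgt := measurable_first_time_gt (n := n) s.
have mDs : measurable_fun setT (fun u : n.-tuple (\bar R) => (D (first_time (tcons (s, u))))%:E).
  apply/measurable_EFinP; apply: measurableT_comp => //.
  apply: measurableT_comp; first exact: measurable_first_time.
  by apply: (measurableT_comp (@measurable_tcons _ _ n)); exact: pair1_measurable.
have -> : ((D s * (1 - F s) ^+ n)%:E =
    \int[Q]_u ((D s)%:E * (\1_[set u | (s < first_time u)%E] u)%:E))%E.
  rewrite ge0_integralZl//; last 2 first.
  - exact/measurable_EFinP/measurable_indic.
  - by rewrite lee_fin.
  rewrite integral_indic// setIT EFinM; congr (_ * _)%E.
  apply/esym; apply: (etrans (product_law_gt _ _ n_gt0)).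
  by rewrite big_const_ord iter_mule mule1 law_gt// EFin_expe.
apply: ge0_le_integral => //.
- by move=> u _; rewrite -EFinM lee_fin mulr_ge0.
- by apply/measurable_EFinP; apply: measurable_funM => //; exact: measurable_indic.
- move=> u _; rewrite -EFinM lee_fin indicE.
  have [/set_mem/= su|_] := boolP (u \in _); last by rewrite mulr0.
  rewrite mulr1 (_ : first_time (tcons (s, u)) = s)//.
  rewrite /first_time big_ord_recl tnth_tcons0.
  by under eq_bigr do rewrite tnth_tconsS; apply/min_idPl/ltW.
Qed.

End race.

(** * First-order conditions *)

Section payoffs.
Context (R : realType) (r : R) (r_gt0 : 0 < r) (n : nat) (n2 : (2 <= n.+1)%N).
Context (C : (\bar R -> R) -> R).
Implicit Types (F G H K : \bar R -> R) (t : \bar R).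

Let cX : is_cdf (discount_cdf r) := cdf_discount r_gt0.
Local Notation L := (cdf_law (discount_cdf r)).

Definition expected_prize F H : R :=
  fine (\int[cdf_law H]_t prize_against r n F t).

Lemma firm1E : firm1 n2 = ord0.
Proof. exact: val_inj. Qed.

Lemma payoff_deviation H F :
  payoff r C (firm1 n2) (deviation (firm1 n2) H F) = expected_prize F H - C H.
Proof.
rewrite firm1E /payoff {2}/deviation eqxx /Rintegral; congr (fine _ - _).
exact: integral_gross_payoff_against.
Qed.

Lemma payoff_symmetric F :
  payoff r C (firm1 n2) (fun=> F) = expected_prize F F - C F.
Proof.
rewrite -payoff_deviation; congr payoff; apply/funext => j.
by rewrite /deviation; case: ifP.
Qed.

Lemma prize_against_le1 F t : is_cdf F -> (0 <= t)%E -> (prize_against r n F t <= 1)%E.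
Proof.
move=> cF t0; apply: (le_trans (prize_against_le _ _ _ _)).
rewrite -[leRHS]mule1; apply: lee_pmul; rewrite ?expe_ge0// ?lee_fin ?discount_ge0//.
  exact: discount_le1.
rewrite -[X in (X ^+ n <= _)%E]fineK; last by rewrite fin_num_measure//; exact: measurable_setgee.
rewrite -EFin_expe lee_fin exprn_ile1// ?fine_ge0// -lee_fin fineK.
  by rewrite probability_le1//; exact: measurable_setgee.
by rewrite fin_num_measure//; exact: measurable_setgee.
Qed.

Lemma integral_prize_against_bounds F H : is_cdf F -> is_cdf H ->
  (0 <= \int[cdf_law H]_t prize_against r n F t <= 1)%E.
Proof.
move=> cF cH; apply/andP; split.
  by apply: integral_ge0 => t _; exact: prize_against_ge0.
apply: (@le_trans _ _ (\int[cdf_law H]_t (cst 1%E t))%E); last first.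
  by rewrite integral_cst// mul1e probability_le1.
apply: le_integral_law => //; [|exact: measurable_prize_against|].
  by move=> t; exact: prize_against_ge0.
by move=> t t0; exact: prize_against_le1.
Qed.

Lemma expected_prizeK F H : is_cdf F -> is_cdf H ->
  (expected_prize F H)%:E = (\int[cdf_law H]_t prize_against r n F t)%E.
Proof.
move=> cF cH; have /andP[p0 p1] := integral_prize_against_bounds cF cH.
by rewrite fineK// ge0_fin_numE// (le_lt_trans p1)// ltry.
Qed.

Lemma expected_prize_bounds F H : is_cdf F -> is_cdf H ->
  0 <= expected_prize F H <= 1.
Proof.
move=> cF cH; rewrite -!lee_fin expected_prizeK//.
exact: integral_prize_against_bounds.
Qed.

Lemma expected_prize_mixture (e : R) F H K : 0 <= e <= 1 -> is_cdf F ->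
  is_cdf H -> is_cdf K -> expected_prize F (mixture e H K) =
  (1 - e) * expected_prize F H + e * expected_prize F K.
Proof.
move=> e01 cF cH cK; apply: EFin_inj.
rewrite expected_prizeK//; last exact: cdf_mixture.
rewrite integral_law_mixture//.
- by rewrite [RHS]EFinD !EFinM !expected_prizeK.
- by move=> t; exact: prize_against_ge0.
- exact: measurable_prize_against.
Qed.

(** The expected prize is affine in the deviator's own cdf, so mixing K into F with weight e changes
    it by exactly e times the difference. Optimality bounds this by the increase in cost; divide by
    e and let e tend to 0. *)
Lemma equilibrium_foc eta (m : (\bar R -> R) -> \bar R -> R) F K :
  cost_density eta C m -> symmetric_equilibrium r C n2 F -> is_cdf K ->
  expected_prize F K - expected_prize F F <=
  \int[eta]_(t in times) (m F t * (K t - F t)).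
Proof.
move=> C_m [cF eqF] cK; have [_ /(_ K cK) cvC] := C_m F cF.
rewrite -(cvg_lim _ cvC)//; apply: limr_ge; first by apply/cvg_ex; eexists; exact: cvC.
near=> e.
have e0 : 0 < e by near: e; exact: nbhs_right_gt.
have e1 : e <= 1 by near: e; exact: nbhs_right_le.
have e01 : 0 <= e <= 1 by rewrite (ltW e0).
have := eqF _ (cdf_mixture e01 cF cK).
rewrite payoff_symmetric payoff_deviation expected_prize_mixture// => h.
rewrite ler_pdivlMl//; lra.
Unshelve. all: by end_near. Qed.

(** Withdrawing an atom p at time 0 forgoes a prize of at most p, while to first order it saves a
    cost of p c_F(0) > p, against [equilibrium_foc]. *)
Lemma equilibrium_at0 eta (m : (\bar R -> R) -> \bar R -> R) F :
  cost_density eta C m -> symmetric_equilibrium r C n2 F ->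
  eta [set +oo%E] = 0%E -> 1 < marginal_cost eta m F 0%E -> F 0%E = 0.
Proof.
move=> C_m eqF eta_oo c1; have [cF _] := eqF.
apply/eqP; rewrite eq_le is_cdf_ge0// andbT leNgt; apply/negP => p0.
set p := F 0%E in p0 *.
have cK := cdf_withdraw cF.
(* As measures, dF plus p times a point mass at [+oo] equals the withdrawn law plus p times a point
   mass at 0. Dividing by the total mass 1 + p turns this into an identity between two mixtures of
   cdfs, to which affinity of the prize applies. *)
pose e := p / (1 + p).
have p1 : 0 < 1 + p by rewrite addr_gt0.
have e01 : 0 <= e <= 1.
  by rewrite /e divr_ge0 ?(ltW p0) ?(ltW p1)//= ler_pdivrMr// mul1r lerDr.
have mixE : mixture e F (fun t => (t == +oo%E)%:R) =
    mixture e (withdraw F) (fun t => if (t < 0)%E then 0 else 1).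
  apply/funext => t; rewrite /mixture /withdraw.
  have [t0|t0] := ltP t 0%E.
    by rewrite (cdf_neg cF t0) lt_eqF// (lt_le_trans t0) ?leey.
  case: eqP => [->|_]; first by rewrite (cdf_infty cF).
  by rewrite mulr0 addr0 -/p /e; field; rewrite gt_eqF.
have := congr1 (expected_prize F) mixE.
rewrite !expected_prize_mixture//; [|exact: cdf_at0|exact: cdf_never].
have /andP[g0 _] := expected_prize_bounds cF (cdf_never R).
have /andP[_ g1] := expected_prize_bounds cF (cdf_at0 R).
have foc := equilibrium_foc C_m eqF cK.
have intE : \int[eta]_(t in times) (m F t * (withdraw F t - F t)) =
    - (p * marginal_cost eta m F 0%E).
  have [mF _] := C_m F cF.
  have mmF := measurable_int _ mF.
  have times_m : measurable (times : set (\bar R)) by exact: measurable_setgee.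
  (* The two cdfs differ by -p at all finite times of the axis and agree at [+oo], which [eta] does
     not charge. *)
  transitivity (\int[eta]_(t in times) (- p * m F t)).
    congr fine; apply: ae_eq_integral => //.
    - apply/measurable_EFinP; apply: measurable_funM; first exact/measurable_EFinP.
      by apply: measurable_funTS; apply: measurable_funB; exact: measurable_cdf.
    - apply/measurable_EFinP; apply: measurable_funM; first exact: measurable_cst.
      exact/measurable_EFinP.
    - exists [set +oo%E]; split => // t /=; apply: contra_notP => t_oo t0.
      rewrite /withdraw ltNge t0/=; case: eqP => // _; congr EFin.
      by rewrite -/p; ring.
  by rewrite RintegralZl// mulNr /marginal_cost.
rewrite intE in foc.
set gF := expected_prize F F in foc *; set gK := expected_prize F (withdraw F) in foc *.
set g0' := expected_prize _ _ in g0 *; set g1' := expected_prize _ _ in g1 *.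
move=> mixg.
have gFK : gF - gK = p * (g1' - g0').
  have e1 : (1 + p) * (1 - e) = 1 by rewrite /e; field; rewrite gt_eqF.
  have e2 : (1 + p) * e = p by rewrite /e; field; rewrite gt_eqF.
  have := congr1 ( *%R (1 + p)) mixg.
  by clearbody e; rewrite !mulrDr !mulrA e1 e2; lra.
have : p * marginal_cost eta m F 0%E <= p * 1.
  have : p * (g1' - g0') <= p * 1 by rewrite ler_pM2l//; lra.
  lra.
by rewrite ler_pM2l// leNgt c1.
Qed.

(** The discount of the first time is the probability that the clock is not earlier. Exchanging the
    two expectations leaves the cdf of the first time integrated against the clock; exchangeability
    gives each firm an equal share. *)
Lemma planner_prizeE H : is_cdf H ->
  planner r C n2 H = n.+1%:R^-1 * (\int[L]_s (1 - (1 - H s) ^+ n.+1)) - C H.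
Proof.
move=> cH; rewrite /planner firm1E /payoff /Rintegral.
congr (_ - _); set P := product_law _.
have PE s : P [set u | (first_time u <= s)%E] = (1 - (1 - H s) ^+ n.+1)%:E.
  rewrite (_ : [set u | _] = ~` [set u : n.+1.-tuple _ | (s < first_time u)%E]); last first.
    by apply/seteqP; split => u /=; rewrite leNgt => /negP.
  rewrite probability_setC; last exact: measurable_first_time_gt.
  rewrite EFinB EFin_expe -law_gt//; congr (_ - _)%E.
  by apply: (etrans (product_law_gt _ _ _)) => //; rewrite big_const_ord iter_mule mule1.
have E : (\int[P]_u (discount r (first_time u))%:E = \int[L]_s (1 - (1 - H s) ^+ n.+1)%:E)%E.
  transitivity (\int[P]_u L [set s | (first_time u <= s)%E])%E.
    (* [discount_law_ge] speaks of nonnegative times, and the first time is almost surely one. *)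
    have f0 : (\forall u \ae P, 0 <= first_time u)%E.
      exists [set u : n.+1.-tuple (\bar R) | (first_time u < 0)%E]; split.
      - rewrite (_ : [set u | _] = ~` [set u | (0 <= first_time u)%E]).
          exact: measurableC (measurable_first_time_ge _).
        by apply/seteqP; split => u /=; rewrite ltNge => /negP.
      - rewrite (_ : [set u | _] = ~` [set u | (0 <= first_time u)%E]); last first.
          by apply/seteqP; split => u /=; rewrite ltNge => /negP.
        rewrite probability_setC.
          rewrite (_ : P _ = 1%E) ?subee//.
          apply: (etrans (product_law_ge _ _)); rewrite big1// => _ _.
          rewrite (_ : [set s | _] = ~` [set s | (s < 0)%E]).
            by rewrite probability_setC ?law_lt0 ?sube0//; exact: measurable_setlte.
          by apply/seteqP; split => u /=; rewrite leNgt => /negP.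
        exact: measurable_first_time_ge.
      - by move=> u /= /negP; rewrite ltNge.
    apply: ge0_ae_eq_integral => //.
    - apply/measurable_EFinP; apply: measurableT_comp; first exact: measurable_discount.
      exact: measurable_first_time.
    - apply: (measurableT_comp (measurable_prob_ge L (g := id) _)) => //.
      exact: measurable_first_time.
    - by move=> u _; rewrite lee_fin discount_ge0.
    - by apply: filterS f0 => u u0 _; rewrite discount_law_ge.
  rewrite (@integral_section _ _ _ P _ _ L
    [set p : (n.+1.-tuple (\bar R)) * \bar R | (first_time p.1 <= p.2)%E]).
    by apply: eq_integral => s _; exact: PE.
  apply: measurable_le_section => //.
  by apply: measurableT_comp => //; exact: measurable_first_time.
have := integral_gross_payoff_iid r (cdf_law H) (ord0 : 'I_n.+1).
rewrite -/P E => /(congr1 fine)/=.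
have -> : (\int[P]_u (gross_payoff r ord0 u)%:E = (expected_prize H H)%:E)%E.
  by rewrite expected_prizeK// -integral_gross_payoff_against.
rewrite -EFinM => /= <-.
by rewrite mulrA mulVf ?mul1r// pnatr_eq0.
Qed.

End payoffs.

(** * First-order condition of the planner *)

Section first_order_comparison.
Context (R : realType) (r : R) (r_gt0 : 0 < r) (n : nat) (n2 : (2 <= n.+1)%N).
Context (C : (\bar R -> R) -> R).
Context (eta : {measure set (\bar R) -> \bar R}).
Context (m : (\bar R -> R) -> \bar R -> R).
Context (C_m : cost_density eta C m).
Implicit Types (F G H K : \bar R -> R) (t : \bar R).

Let cX : is_cdf (discount_cdf r) := cdf_discount r_gt0.
Local Notation L := (cdf_law (discount_cdf r)).

Lemma measurable_times : measurable (times : set (\bar R)).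
Proof. exact: measurable_setgee. Qed.

Lemma integrable_density_mul F (D : \bar R -> R) : is_cdf F ->
  measurable_fun setT D -> (forall t, `|D t| <= 1) ->
  eta.-integrable times (EFin \o (fun t => m F t * D t)).
Proof.
move=> cF mD D1; have [mF _] := C_m cF.
have mmF := measurable_int _ mF.
apply: le_integrable mF => //; first exact: measurable_times.
  apply/measurable_EFinP; apply: measurable_funM; first exact/measurable_EFinP.
  exact: measurable_funTS.
by move=> t _; rewrite /= lee_fin normrM ler_piMr.
Qed.

Lemma cdf_diff_le1 H K t : is_cdf H -> is_cdf K -> `|H t - K t| <= 1.
Proof.
move=> cH cK; have := is_cdf_ge0 t cH; have := is_cdf_le1 t cH.
have := is_cdf_ge0 t cK; have := is_cdf_le1 t cK; rewrite ler_norml; lra.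
Qed.

Lemma integrable_survival F (D : \bar R -> R) k : is_cdf F ->
  measurable_fun setT D -> (forall t, `|D t| <= 1) ->
  L.-integrable setT (EFin \o (fun s => D s * (1 - F s) ^+ k)).
Proof.
move=> cF mD D1; apply: (@integrable_prob_bounded _ _ _ _ _ 1).
  apply: measurable_funM => //; apply: measurable_funX.
  by apply: measurable_funB => //; exact: measurable_cdf.
have F0 t : 0 <= 1 - F t by rewrite subr_ge0 is_cdf_le1.
move=> t; rewrite normrM mulr_ile1// ger0_norm ?exprn_ge0// exprn_ile1//.
by rewrite gerBl is_cdf_ge0.
Qed.

(** All firms move together, so the prize is polynomial rather than affine in the mixing weight e.
    Since K <= G, mixing raises the survival function by e(G - K) >= 0, and [exprSB_le_quadratic]
    bounds the lost share of the prize by e times the integral on the left plus O(e^2). *)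
Lemma planner_foc G K : planner_optimal r C n2 G -> is_cdf K ->
  (forall t, K t <= G t) ->
  - (\int[L]_s ((G s - K s) * (1 - G s) ^+ n)) <=
  \int[eta]_(t in times) (m G t * (K t - G t)).
Proof.
move=> [cG optG] cK KG; have [_ /(_ K cK) cvC] := C_m cG.
set A := Rintegral _ _ _.
(* The term [n%:R * e] is the quadratic remainder of the prize after division by e; it vanishes in
   the limit and makes the inequality hold for each e. *)
have cvC' : e^-1 * (C (mixture e G K) - C G) + n%:R * e @[e --> 0^'+] -->
    \int[eta]_(t in times) (m G t * (K t - G t)).
  rewrite -[X in _ --> X]addr0 -[X in _ --> _ + X](mulr0 n%:R).
  apply: cvgD; first exact: cvC.
  apply: cvgM; first exact: cvg_cst.
  exact: (@cvg_at_right_filter R R id 0 0 cvg_id).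
rewrite -(cvg_lim _ cvC')//; apply: limr_ge; first by apply/cvg_ex; eexists; exact: cvC'.
near=> e.
have e0 : 0 < e by near: e; exact: nbhs_right_gt.
have e1 : e <= 1 by near: e; exact: nbhs_right_le.
have e01 : 0 <= e <= 1 by rewrite (ltW e0).
have cM := cdf_mixture e01 cG cK.
have := optG _ cM; rewrite !planner_prizeE//.
have n0 : (0 : R) < n.+1%:R by rewrite ltr0n.
have D1 t : `|G t - K t| <= 1 by exact: cdf_diff_le1.
have mD : measurable_fun setT (fun t => G t - K t).
  by apply: measurable_funB; exact: measurable_cdf.
have intX H k : is_cdf H -> L.-integrable setT (EFin \o (fun s => 1 - (1 - H s) ^+ k)).
  move=> cH; apply: (@integrable_prob_bounded _ _ _ _ _ 1).
    apply: measurable_funB => //; apply: measurable_funX.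
    by apply: measurable_funB => //; exact: measurable_cdf.
  have H0 t : 0 <= 1 - H t by rewrite subr_ge0 is_cdf_le1.
  have H1 t : 1 - H t <= 1 by rewrite gerBl is_cdf_ge0.
  by move=> t; rewrite ger0_norm ?subr_ge0 ?exprn_ile1// gerBl exprn_ge0.
(* The remainder carries the factor (G - K)^2, which is bounded by 1. *)
have key : \int[L]_s (1 - (1 - G s) ^+ n.+1) - \int[L]_s (1 - (1 - mixture e G K s) ^+ n.+1)
    <= n.+1%:R * e * (A + n%:R * e).
  have iB := integrable_survival n cG mD D1.
  have ic : L.-integrable setT (EFin \o cst (n%:R * e)).
    by apply: (@integrable_prob_bounded _ _ _ _ _ `|n%:R * e|) => //; exact: measurable_cst.
  have iBc : L.-integrable setT (EFin \o
      (fun s => (G s - K s) * (1 - G s) ^+ n + n%:R * e)) by exact: (integrableD measurableT iB ic).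
  rewrite -RintegralB//; [|exact: intX|exact: intX].
  have -> : n.+1%:R * e * (A + n%:R * e) =
      \int[L]_s (n.+1%:R * e * ((G s - K s) * (1 - G s) ^+ n + n%:R * e)).
    rewrite RintegralZl// RintegralD//.
    rewrite Rintegral_cst// (_ : fine _ = 1) ?mulr1//.
    exact: (congr1 fine (probability_setT L)).
  apply: le_Rintegral => //.
  - exact: (integrableB measurableT (intX _ n.+1 cG) (intX _ n.+1 cM)).
  - exact: (integrableZl measurableT _ iBc).
  move=> s _.
  have -> : 1 - (1 - G s) ^+ n.+1 - (1 - (1 - mixture e G K s) ^+ n.+1) =
    (1 - mixture e G K s) ^+ n.+1 - (1 - G s) ^+ n.+1 by ring.
  have y0 : 0 <= 1 - G s by rewrite subr_ge0 is_cdf_le1.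
  have ya : 1 - G s <= 1 - mixture e G K s.
    by rewrite lerB// /mixture; have := KG s; nra.
  have a1 : 1 - mixture e G K s <= 1 by rewrite gerBl is_cdf_ge0.
  have aE : 1 - mixture e G K s - (1 - G s) = e * (G s - K s).
    by rewrite /mixture; ring.
  apply: (le_trans (exprSB_le_quadratic n y0 ya a1)).
  rewrite aE -!mulrA ler_pM2l// ler_pM2l//.
  have KG0 : 0 <= G s - K s by rewrite subr_ge0.
  have KG1 : G s - K s <= 1 by have := D1 s; rewrite ger0_norm.
  rewrite mulrDr lerD2l.
  have : (G s - K s) * (n%:R * (e * (G s - K s))) = n%:R * e * (G s - K s) ^+ 2 by ring.
  by move=> ->; rewrite ler_piMr ?mulr_ge0 ?(ltW e0)// exprn_ile1.
set IG := \int[L]_s (1 - (1 - G s) ^+ n.+1) in key *.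
set IM := \int[L]_s (1 - (1 - mixture e G K s) ^+ n.+1) in key *.
rewrite lerBlDr -addrA -lerBlDl -mulrBr ler_pdivrMl// => h.
have {h key} : n.+1%:R * (e * - (A + n%:R * e)) <= n.+1%:R * (- C G + C (mixture e G K)).
  by apply: le_trans h; rewrite -lerN2 opprB mulrN mulrN opprK mulrA.
rewrite ler_pM2l// [leRHS]addrC -ler_pdivlMl// opprD => h.
by rewrite -lerBlDr.
Unshelve. all: by end_near. Qed.

End first_order_comparison.

(** * Vanishing advances *)

Section advance_limit.
Context (R : realType) (C : (\bar R -> R) -> R).
Context (eta : {measure set (\bar R) -> \bar R}).
Context (m : (\bar R -> R) -> \bar R -> R) (C_m : cost_density eta C m).
Implicit Types (F G H K : \bar R -> R) (t : \bar R).

Lemma cvg_advance H t : is_cdf H -> (0 <= t)%E ->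
  advance (k.+1%:R^-1) H t @[k --> \oo] --> H t.
Proof.
move=> cH; rewrite /advance; case: t => [t t0| _|//]; last first.
  by rewrite ltNge leey/=; apply: cvg_near_cst; exact: nearW.
rewrite ltNge t0/=.
have /= := cdf_right_cont cH (t0 : 0 <= t).
move=> /cvg_at_rightP/(_ (fun k => t + k.+1%:R^-1)); apply; split.
  by move=> k; rewrite ltrDl invr_gt0 ltr0n.
rewrite -[X in _ --> X]addr0; apply: cvgD; [exact: cvg_cst|exact: cvg_harmonic].
Qed.

(** Because of ties the prize may jump as d tends to 0, so its lower bound a is kept free of d and
    only the cost side passes to the limit: advances converge by right continuity, and |m_F|
    dominates. *)
Lemma le_integral_advance F H (a : R) : is_cdf F -> is_cdf H ->
  (forall d, 0 < d -> a <= \int[eta]_(t in times) (m F t * (advance d H t - F t))) ->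
  a <= \int[eta]_(t in times) (m F t * (H t - F t)).
Proof.
move=> cF cH a_le; have [mF _] := C_m cF; have mmF := measurable_int _ mF.
have mdiff K : is_cdf K -> measurable_fun setT (fun t => K t - F t).
  by move=> cK; apply: measurable_funB; exact: measurable_cdf.
have cA k : is_cdf (advance (k.+1%:R^-1) H).
  by apply: cdf_advance => //; rewrite invr_ge0.
have intmK K : is_cdf K -> eta.-integrable times (EFin \o (fun t => m F t * (K t - F t))).
  move=> cK; apply: (integrable_density_mul C_m cF (mdiff _ cK)) => t.
  exact: cdf_diff_le1.
have cv : (\int[eta]_(t in times) (m F t * (advance k.+1%:R^-1 H t - F t))%:E)%E
    @[k --> \oo] --> (\int[eta]_(t in times) (m F t * (H t - F t))%:E)%E.
  apply: (@dominated_cvg _ _ _ eta times (measurable_times R)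
    (fun k t => (m F t * (advance k.+1%:R^-1 H t - F t))%:E)
    (fun t => (m F t * (H t - F t))%:E) (fun t => `|(m F t)%:E|%E)) => //.
  - by move=> k; exact: measurable_int (intmK _ (cA k)).
  - move=> t t0; apply: cvg_EFin; first by near=> k.
    apply: cvgM; first exact: cvg_cst.
    by apply: cvgB; [exact: cvg_advance|exact: cvg_cst].
  - exact: integrable_abse.
  - move=> k t _; rewrite lee_fin normrM ler_piMr//; exact: cdf_diff_le1.
have iH := integrable_fin_num (measurable_times R) (intmK _ cH).
have {}cv : \int[eta]_(t in times) (m F t * (advance k.+1%:R^-1 H t - F t))
    @[k --> \oo] --> \int[eta]_(t in times) (m F t * (H t - F t)).
  by apply: fine_cvg; rewrite fineK.
rewrite -(cvg_lim _ cv)//; apply: limr_ge; first by apply/cvg_ex; eexists; exact: cv.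
by apply: nearW => k; apply: a_le; rewrite invr_gt0 ltr0n.
Unshelve. all: by end_near. Qed.

End advance_limit.

(** * Comparison of equilibrium and optimum *)

Lemma theorem5p3_succ (R : realType) (n : nat) (n2 : (2 <= n.+1)%N)
    (r : R) (r_gt0 : 0 < r)
    (eta : {measure set (\bar R) -> \bar R})
    (eta_infty : eta [set +oo%E] = 0%E)
    (C : (\bar R -> R) -> R)
    (m : (\bar R -> R) -> \bar R -> R)
    (C_m : cost_density eta C m)
    (m_mono : monotone_density eta m)
    (F G : \bar R -> R)
    (c_gt1 : 1 < marginal_cost eta m F 0%E)
    (F_eq : symmetric_equilibrium r C n2 F)
    (G_opt : planner_optimal r C n2 G) (t : \bar R) : (0 <= t)%E -> G t <= F t.
Proof.
have [cF _] := F_eq; have [cG _] := G_opt.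
have cX : is_cdf (discount_cdf r) := cdf_discount r_gt0.
have n0 : (0 < n)%N by rewrite -ltnS.
have F0 := equilibrium_at0 r_gt0 C_m F_eq eta_infty c_gt1.
pose L := cdf_law (discount_cdf r).
pose H s := Num.max (F s) (G s); pose K s := Num.min (F s) (G s).
have cH : is_cdf H by exact: cdf_max.
have cK : is_cdf K by exact: cdf_min.
(* The same D measures both deviations: from F up to H and from G down to K. *)
pose D s := Num.max (G s - F s) 0.
have HD s : H s - F s = D s.
  by rewrite /H /D; case: (leP (F s) (G s)) => FG;
    [rewrite max_l ?subr_ge0|rewrite max_r ?subrr// subr_le0 ltW].
have KD s : G s - K s = D s.
  by rewrite /K /D; case: (leP (F s) (G s)) => FG;
    [rewrite max_l ?subr_ge0|rewrite max_r ?subrr// subr_le0 ltW].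
have D0 s : 0 <= D s by rewrite le_max lexx orbT.
have mD : measurable_fun setT D.
  by rewrite (_ : D = fun s => H s - F s);
    [apply: measurable_funB; exact: measurable_cdf|apply/funext => s; rewrite HD].
have D1 s : `|D s| <= 1 by rewrite -HD cdf_diff_le1.
pose A H' := \int[L]_s (D s * (1 - H' s) ^+ n).
have iA H' : is_cdf H' -> L.-integrable setT (EFin \o (fun s => D s * (1 - H' s) ^+ n)).
  by move=> cH'; exact: integrable_survival.
have imD H' : is_cdf H' -> eta.-integrable times (EFin \o (fun s => m H' s * D s)).
  by move=> cH'; exact: (integrable_density_mul C_m).
have AF_le : A F <= \int[eta]_(s in times) (m F s * D s).
  under eq_Rintegral do rewrite -HD.
  apply: (le_integral_advance C_m) => // d d0.
  apply: le_trans (equilibrium_foc r_gt0 C_m F_eq (cdf_advance (ltW d0) cH)).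
  rewrite lerBrDr -lee_fin EFinD !expected_prizeK//; last exact: cdf_advance (ltW d0) cH.
  apply: le_trans (integral_prize_against_advance r_gt0 n0 cF F0 cH d0).
  (* The advanced H earns at least its fair prize and F at most its own, so the gain is at least the
     fair prize of the difference D, which [fair_prize_gain] bounds below by [A F]. *)
  have -> : (fair_prize r n F H = fair_prize r n F D + fair_prize r n F F)%E.
    rewrite /fair_prize -ge0_integralD//.
    - by apply: eq_integral => u _; rewrite -EFinD -HD subrK.
    - by move=> u _; rewrite lee_fin.
    - apply/measurable_EFinP; apply: measurableT_comp => //; exact: measurable_first_time.
    - by move=> u _; rewrite lee_fin is_cdf_ge0.
    - apply/measurable_EFinP; apply: measurableT_comp; first exact: measurable_cdf.
      exact: measurable_first_time.
  apply: leeD; last exact: integral_prize_against_le.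
  rewrite /A /Rintegral fineK; first exact: fair_prize_gain.
  exact: integrable_fin_num (iA F cF).
have AG_ge : \int[eta]_(s in times) (m G s * D s) <= A G.
  have KG s : K s <= G s by rewrite ge_min lexx orbT.
  have := planner_foc r_gt0 C_m G_opt cK KG.
  have -> : \int[L]_s ((G s - K s) * (1 - G s) ^+ n) = A G.
    by apply: eq_Rintegral => s _; rewrite KD.
  suff -> : \int[eta]_(s in times) (m G s * (K s - G s)) =
      - \int[eta]_(s in times) (m G s * D s) by rewrite lerN2.
  rewrite -mulN1r -RintegralZl//; [|exact: measurable_times|exact: imD].
  by apply: eq_Rintegral => s _; rewrite -(opprB (G s)) KD; ring.
have mono : \int[eta]_(s in times) (m F s * D s) <= \int[eta]_(s in times) (m G s * D s).
  rewrite -subr_ge0 -RintegralB//; [|exact: measurable_times|exact: imD|exact: imD].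
  have := m_mono _ _ cF cG; congr (_ <= _); apply: eq_Rintegral => s _.
  by rewrite -mulrBl mulrC.
have AFG : A F <= A G by apply: le_trans AF_le (le_trans mono AG_ge).
move=> t0; rewrite leNgt; apply/negP => FGt.
case: t t0 FGt => [x| |//]; last by rewrite (cdf_infty cF) (cdf_infty cG) ltxx.
rewrite lee_fin => x0 FGx.
(* g is the difference of the integrands of [A F] and [A G]. It is nonnegative, and positive
   wherever F < G because there is at least one rival; so [AFG] forces it to vanish almost
   everywhere for the clock. *)
pose g s := D s * (1 - F s) ^+ n - D s * (1 - G s) ^+ n.
have sub0 H' s : is_cdf H' -> 0 <= 1 - H' s by move=> cH'; rewrite subr_ge0 is_cdf_le1.
have gD s : g s = D s * ((1 - F s) ^+ n - (1 - G s) ^+ n) by rewrite /g mulrBr.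
have g_gt0 s : F s < G s -> 0 < g s.
  move=> FG; rewrite gD /D max_l ?subr_ge0 ?ltW// mulr_gt0 ?subr_gt0//.
  by rewrite ltrXn2r ?sub0// ?ltrD2l ?ltrN2// -lt0n.
have g_ge0 s : 0 <= g s.
  have [FG|GF] := ltP (F s) (G s); first exact/ltW/g_gt0.
  by rewrite gD /D max_r ?subr_le0// mul0r.
have ig : L.-integrable setT (EFin \o g).
  exact: (integrableB measurableT (iA F cF) (iA G cG)).
have g0 : (\int[L]_s `|(g s)%:E| = 0)%E.
  under eq_integral do rewrite gee0_abs ?lee_fin//.
  apply/eqP; rewrite eq_le integral_ge0 ?andbT//; last by move=> s _; rewrite lee_fin.
  rewrite -[leLHS]fineK; last exact: integrable_fin_num ig.
  rewrite lee_fin -/(Rintegral _ _ _) RintegralB//; [|exact: iA|exact: iA].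
  by rewrite subr_le0.
have [N [mN N0 gN]] := (ae_eq_integral_abs L measurableT (measurable_int _ ig)).1 g0.
have cvD : G y%:E - F y%:E @[y --> x^'+] --> G x%:E - F x%:E.
  by apply: cvgB; exact: cdf_right_cont.
have [e /= e0 He] : \forall y \near x^'+, 0 < G y%:E - F y%:E.
  by apply: (cvgr_gt _ cvD); rewrite subr_gt0.
(* Half the radius keeps y inside the neighbourhood, so F < G on all of ]x, y]. *)
pose y := x + e / 2.
have xy : x < y by rewrite ltrDl divr_gt0.
have sub : [set s : \bar R | (x%:E < s <= y%:E)%E] `<=` N.
  move=> [s| |] /=; rewrite ?leye_eq ?andbF//.
  rewrite lte_fin lee_fin => /andP[xs sy]; apply: gN => /= /(_ I) [].
  apply/eqP; rewrite gt_eqF// g_gt0// -subr_gt0; apply: He => //=.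
  rewrite ltr0_norm ?subr_lt0// opprB ltrBlDl; apply: le_lt_trans sy _.
  by rewrite ltrD2l gtr_pMr// invf_lt1// ltr1n.
(* Since ]x, y] lies in the null set N, the cdf of the clock cannot grow from x to y, but it is
   strictly increasing on finite nonnegative times. *)
have LE : (L [set s | (s <= y%:E)%E] <= L ([set s | (s <= x%:E)%E] `|` N))%E.
  apply: le_measure; rewrite ?inE; first exact: measurable_setlee.
    by apply: measurableU => //; exact: measurable_setlee.
  move=> s /= sy; have [sx|xs] := leP s x%:E; [by left|right; apply: sub => /=].
  by rewrite xs.
have LU : (L ([set s | (s <= x%:E)%E] `|` N) <= L [set s | (s <= x%:E)%E] + L N)%E.
  by apply: measureU2 => //; exact: measurable_setlee.
have := le_trans LE LU; rewrite N0 adde0 !law_le// lee_fin.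
rewrite /discount_cdf !lte_fin !ltNge x0 (le_trans x0 (ltW xy))/=.
by rewrite lerD2l lerN2 ler_expR lerN2 ler_pM2l// leNgt xy.
Qed.

Theorem theorem5p3 (R : realType) (n : nat) (n2 : (2 <= n)%N)
    (r : R) (r_gt0 : 0 < r)
    (eta : {finite_measure set (\bar R) -> \bar R})
    (eta_times : eta [set t : \bar R | (t < 0)%E] = 0%E)
    (eta_nonatomic : nonatomic eta)
    (eta_infty : eta [set +oo%E] = 0%E)
    (C : (\bar R -> R) -> R)
    (m : (\bar R -> R) -> \bar R -> R)
    (C_m : cost_density eta C m)
    (m_mono : monotone_density eta m)
    (c_ge : exists eta0 : R, 0 < eta0 /\
      forall H : \bar R -> R, is_cdf H -> 1 + eta0 <= marginal_cost eta m H 0%E)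
    (F G : \bar R -> R)
    (F_eq : symmetric_equilibrium r C n2 F)
    (G_opt : planner_optimal r C n2 G) :
  forall t : \bar R, (0 <= t)%E -> G t <= F t.
Proof.
(* From here on [n] is the number of rivals of a firm. *)
case: n n2 F_eq G_opt => // n n2 F_eq G_opt.
have [eta0 [eta0_gt0 c_F]] := c_ge; have [cF _] := F_eq.
apply: (theorem5p3_succ r_gt0 eta_infty C_m m_mono _ F_eq G_opt).
by apply: lt_le_trans (c_F _ cF); rewrite ltrDl.
Qed.
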